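(* Let $s_0=1,s_1,s_2,\ldots$ be a sequence of real numbers such that for every $N\in\mathbb{N}$ the Hankel matrix $(s_{i+j-2})_{1\le i,j\le N}$ is positive definite. The Hamburger moment problem for $(s_k)$ is indeterminate if and only if $$\lim_{T\to\infty}\left(\left(C^T\right)^{-1}\Gamma_T,\Gamma_T\right)<+\infty\quad\text{and}\quad \lim_{T\to\infty}\left(\left(C^T\right)^{-1}\Omega_T,\Omega_T\right)<+\infty,$$ where $\Gamma_T=(\mathcal{T}_T(0),\mathcal{T}_{T-1}(0),\ldots,\mathcal{T}_1(0))^{\top}$ and $\Omega_T=(\mathcal{T}_T'(0),\mathcal{T}_{T-1}'(0),\ldots,\mathcal{T}_1'(0))^{\top}$.
   Context: The Hamburger moment problem asks for a Borel measure $\rho$ on $\mathbb{R}$ with $s_k=\int_{\mathbb{R}}\lambda^k\,d\rho(\lambda)$ for all $k\ge0$; it is determinate if it has only one solution and indeterminate if it has more than one. The polynomials $\mathcal{T}_t(\lambda)$ are defined by $\mathcal{T}_0=0$, $\mathcal{T}_1=1$, $\mathcal{T}_{t+1}+\mathcal{T}_{t-1}-\lambda\mathcal{T}_t=0$; thus $\mathcal{T}_{2n-1}(0)=(-1)^{n-1}$, $\mathcal{T}_{2n}(0)=0$, $\mathcal{T}'_{2n-1}(0)=0$, $\mathcal{T}'_{2n}(0)=(-1)^{n-1}n$ for $n\ge1$. Define $r_{t-1}$, $t\ge1$, by replacing each power $\lambda^k$ in $\mathcal{T}_t(\lambda)$ by $s_k$ (i.e. $r_{t-1}=\int\mathcal{T}_t\,d\rho$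 for any measure $\rho$ with moments $s_k$). The connecting matrix $C^T$ is the $T\times T$ matrix $$C^T_{ij}=\sum_{k=0}^{T-\max\{i,j\}}r_{|i-j|+2k},\qquad i,j=1,\ldots,T,$$ which is positive definite; equivalently, $C^T_{l+1,m+1}=\int\mathcal{T}_{T-l}\mathcal{T}_{T-m}\,d\rho$, $l,m=0,\ldots,T-1$. $(\cdot,\cdot)$ is the standard inner product. *)

(* Defs.v *)
From HB Require Import structures.
From mathcomp Require Import all_boot all_order all_algebra.
From mathcomp Require Import all_classical all_reals all_analysis.

Set Implicit Arguments.
Unset Strict Implicit.
Unset Printing Implicit Defensive.

Import Order.TTheory GRing.Theory Num.Theory.
Import numFieldNormedType.Exports.
Local Open Scope classical_set_scope.
Local Open Scope ring_scope.

Section MatrixNotions.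
Variable R : realType.

Definition dotprod (n : nat) (u v : 'cV[R]_n) : R := \sum_i u i 0 * v i 0.

Definition posdefmx (n : nat) (A : 'M[R]_n) : Prop :=
  A^T = A /\ forall v : 'cV[R]_n, v != 0 -> 0 < dotprod (A *m v) v.

(* Rows and columns are numbered from 0, hence s (i + j) for s_{i+j-2}. *)
Definition hankelmx (s : nat -> R) (N : nat) : 'M[R]_N :=
  \matrix_(i < N, j < N) s (i + j)%N.

End MatrixNotions.

Section MomentProblem.
Variable R : realType.

(* measurableTypeR R is R with its Borel sigma-algebra.  Integrability is required
   explicitly because \int[rho] f also has a value when f is not integrable. *)
Definition hamburger_solution (s : nat -> R)
    (rho : {measure set (measurableTypeR R) -> \bar R}) : Prop :=
  forall k : nat,
    rho.-integrable [set: measurableTypeR R] (fun x => (x ^+ k)%:E) /\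
    (\int[rho]_(x in [set: measurableTypeR R]) (x ^+ k)%:E)%E = (s k)%:E.

(* Two measures are distinct when they differ on some Borel set: their values
   on non-measurable sets are irrelevant. *)
Definition hamburger_indeterminate (s : nat -> R) : Prop :=
  exists rho1 rho2 : {measure set (measurableTypeR R) -> \bar R},
    [/\ hamburger_solution s rho1, hamburger_solution s rho2 &
        exists2 A : set (measurableTypeR R), measurable A & rho1 A <> rho2 A].

End MomentProblem.

Section ConnectingMatrix.
Variable R : realType.

Fixpoint chebT (t : nat) : {poly R} :=
  if t is t1.+1 then
    if t1 is t2.+1 then 'X * chebT t1 - chebT t2 else 1
  else 0.

Definition moment_functional (s : nat -> R) (p : {poly R}) : R :=
  \sum_(k < size p) p`_k * s k.

(* With t >= 1 shifted by one: r_t comes from T_{t+1}. *)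
Definition response (s : nat -> R) (t : nat) : R :=
  moment_functional s (chebT t.+1).

(* i and j are numbered from 0, so that the 1-based indices are i.+1, j.+1;
   the upper summation bound T - max is inclusive. *)
Definition connecting_mx (s : nat -> R) (T : nat) : 'M[R]_T :=
  \matrix_(i < T, j < T)
    \sum_(0 <= k < (T - maxn i.+1 j.+1).+1)
       response s (`|i.+1 - j.+1|%N + 2 * k)%N.

Definition Gamma_vec (T : nat) : 'cV[R]_T := \col_(i < T) (chebT (T - i)).[0].

Definition Omega_vec (T : nat) : 'cV[R]_T :=
  \col_(i < T) ((chebT (T - i))^`()).[0].

End ConnectingMatrix.

Arguments chebT {R} t.
Arguments Gamma_vec {R} T.
Arguments Omega_vec {R} T.

(* Main.v *)
(* Let L be the moment functional on polynomials and (P_n) its orthonormal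
   polynomials.  In the basis T_T, ..., T_1 the matrix C^T is the Gram matrix of L,
   so the two quadratic forms are the partial sums of P_n(0)^2 and P_n'(0)^2.
   For a polynomial w, the map p |-> p %/ w has in the basis (P_n) a strictly
   triangular matrix whose entries are combinations of products of the
   coefficients of P_n %% w and of the numbers L(X^i (P_n %/ w)).  When these
   sequences are square summable the matrix is Hilbert-Schmidt, and a discrete
   Gronwall inequality shows that (P_n(t)) and (P_n'(t)) are square summable for
   every real t.

   If both sums converge, this applies to w = X and gives p(t)^2 <= M L(p^2) for
   all t in [0,1] with a uniform M.  Then L - M^-1 delta_t is still positive, hence
   (M. Riesz extension, then a Stieltjes measure) it is represented by a measure,
   and there are solutions with an atom of mass at least M^-1 at any prescribed
   t in [0,1]; a single finite measure cannot have all these atoms.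

   Conversely, for two distinct solutions some integral of 1/w with
   w = (X - a)^2 + b^2 differs, by the uniqueness of the Stieltjes transform.
   Comparing the integrals of P_n/w and X P_n/w recovers the remainders P_n %% w,
   and Bessel's inequality makes all the sequences square summable. *)
Require Import Defs.
From HB Require Import structures.
From mathcomp Require Import all_boot all_order all_algebra.
From mathcomp Require Import all_classical all_reals all_analysis.
From mathcomp Require Import measurable_realfun ring lra zify.

Set Implicit Arguments.
Unset Strict Implicit.
Unset Printing Implicit Defensive.

Import Order.TTheory GRing.Theory Num.Theory.
Import numFieldNormedType.Exports.
Local Open Scope classical_set_scope.
Local Open Scope ring_scope.

(** * Orthonormal polynomials *)

Lemma poly_sum_coefXn (R : nzRingType) n (p : {poly R}) : (size p <= n)%N ->
  p = \sum_(i < n) p`_i *: 'X^i.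
Proof.
move=> pn; apply/polyP => k; rewrite coef_sum; under eq_bigr do rewrite coefZ coefXn.
case: (ltnP k n) => kn.
  rewrite (bigD1 (Ordinal kn))//= eqxx mulr1 big1 ?addr0// => i.
  by rewrite -val_eqE/= eq_sym => /negPf ->; rewrite mulr0.
rewrite nth_default ?(leq_trans pn)// big1// => i _.
by rewrite gtn_eqF ?mulr0// (leq_trans (ltn_ord i)).
Qed.

Section MomentFunctional.
Variables (R : realType) (s : nat -> R).
Implicit Types p q : {poly R}.
Local Notation L := (moment_functional s).

Lemma moment_functionalE n p : (size p <= n)%N -> L p = \sum_(k < n) p`_k * s k.
Proof.
move=> le_n; rewrite /moment_functional -!(big_mkord xpredT (fun k => p`_k * s k)).
rewrite [RHS](big_cat_nat _ le_n)//= [X in _ = _ + X]big_nat_cond.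
rewrite [X in _ = _ + X]big1 ?addr0// => i /andP[/andP[le_i _] _].
by rewrite nth_default ?mul0r.
Qed.

Lemma moment_functional_linear a p q : L (a *: p + q) = a * L p + L q.
Proof.
pose n := maxn (size p) (size q).
have hp : (size p <= n)%N by rewrite leq_maxl.
have hq : (size q <= n)%N by rewrite leq_maxr.
have hpq : (size (a *: p + q)%R <= n)%N.
  rewrite (leq_trans (size_polyD _ _))// geq_max hq andbT.
  exact: leq_trans (size_scale_leq _ _) hp.
rewrite !(@moment_functionalE n)// mulr_sumr -big_split/=.
by apply: eq_bigr => i _; rewrite coefD coefZ mulrDl mulrA.
Qed.

Lemma moment_functional0 : L 0 = 0.
Proof. by rewrite /moment_functional size_poly0 big_ord0. Qed.

Lemma moment_functionalD p q : L (p + q) = L p + L q.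
Proof. by rewrite -[p]scale1r moment_functional_linear mul1r scale1r. Qed.

Lemma moment_functionalZ a p : L (a *: p) = a * L p.
Proof. by rewrite -[_ *: _]addr0 moment_functional_linear moment_functional0 addr0. Qed.

Lemma moment_functionalN p : L (- p) = - L p.
Proof. by rewrite -scaleN1r moment_functionalZ mulN1r. Qed.

Lemma moment_functionalB p q : L (p - q) = L p - L q.
Proof. by rewrite moment_functionalD moment_functionalN. Qed.

Lemma moment_functional_sum I (r : seq I) (P : pred I) (F : I -> {poly R}) :
  L (\sum_(i <- r | P i) F i) = \sum_(i <- r | P i) L (F i).
Proof. exact: (big_morph L moment_functionalD moment_functional0). Qed.

Lemma moment_functionalXn k : L 'X^k = s k.
Proof.
rewrite (@moment_functionalE k.+1) ?size_polyXn// (bigD1 ord_max)//= coefXn eqxx.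
rewrite mul1r big1 ?addr0// => i ik; rewrite coefXn; move: ik.
by rewrite -val_eqE/= => /negPf ->; rewrite mul0r.
Qed.

Lemma moment_functional_sqr p n : (size p <= n)%N ->
  L (p * p) = dotprod (hankelmx s n *m (\col_i p`_i)) (\col_i p`_i).
Proof.
move=> pn.
have -> : p * p = \sum_(i < n) \sum_(j < n) (p`_i * p`_j) *: 'X^(i + j).
  rewrite {1 2}(poly_sum_coefXn pn).
  rewrite mulr_suml; apply: eq_bigr => i _; rewrite mulr_sumr.
  by apply: eq_bigr => j _; rewrite -scalerAl -scalerAr scalerA exprD.
rewrite moment_functional_sum /dotprod; apply: eq_bigr => i _.
rewrite moment_functional_sum !mxE mulr_suml; apply: eq_bigr => j _.
by rewrite moment_functionalZ moment_functionalXn !mxE; ring.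
Qed.

Section Orthonormal.
Hypothesis s_pos : forall N : nat, posdefmx (hankelmx s N).

Lemma moment_functional_sqr_gt0 p : p != 0 -> 0 < L (p * p).
Proof.
move=> p0; rewrite (@moment_functional_sqr p (size p))//.
apply: (s_pos (size p)).2; apply: contraNneq p0 => /matrixP p0.
rewrite -lead_coef_eq0 lead_coefE; case: (posnP (size p)) => [/eqP|sp].
  by rewrite size_poly_eq0 => /eqP ->; rewrite coef0.
have hp : ((size p).-1 < size p)%N by rewrite prednK.
by have := p0 (Ordinal hp) 0; rewrite !mxE => ->.
Qed.

Lemma moment_functional_sqr_ge0 p : 0 <= L (p * p).
Proof.
have [->|/moment_functional_sqr_gt0/ltW//] := eqVneq p 0.
by rewrite mul0r moment_functional0.
Qed.

(** The recursion returns the whole list because each step projects onto all earlier polynomials;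
    [orthopoly n] is the last entry of the list of length [n.+1]. *)
Fixpoint gram_schmidt n : seq {poly R} :=
  if n is m.+1 then
    let g := gram_schmidt m in
    let q := 'X^m - \sum_(r <- g) L ('X^m * r) *: r in
    rcons g ((Num.sqrt (L (q * q)))^-1 *: q)
  else [::].

Definition orthopoly n := nth 0 (gram_schmidt n.+1) n.
Local Notation P := orthopoly.

Lemma size_gram_schmidt n : size (gram_schmidt n) = n.
Proof. by elim: n => //= n IHn; rewrite size_rcons IHn. Qed.

Lemma nth_gram_schmidt n k : (k < n)%N -> (gram_schmidt n)`_k = P k.
Proof.
elim: n => // n IHn; rewrite ltnS leq_eqVlt => /predU1P[->//|kn].
by rewrite /= nth_rcons size_gram_schmidt kn IHn.
Qed.

Let monic_residue n := 'X^n - \sum_(k < n) L ('X^n * P k) *: P k.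

Lemma orthopolyE n : P n =
  (Num.sqrt (L (monic_residue n * monic_residue n)))^-1 *: monic_residue n.
Proof.
rewrite /orthopoly /= nth_rcons size_gram_schmidt ltnn eqxx /monic_residue.
rewrite (big_nth 0) size_gram_schmidt big_mkord.
by under eq_bigr do rewrite nth_gram_schmidt//.
Qed.

Lemma size_orthopoly n : size (P n) = n.+1.
Proof.
elim/ltn_ind: n => n IHn; rewrite orthopolyE.
have sz : size (monic_residue n) = n.+1.
  rewrite /monic_residue size_polyDl ?size_polyXn// size_polyN ltnS.
  apply: (leq_trans (size_sum _ _ _)); apply/bigmax_leqP => k _.
  by rewrite (leq_trans (size_scale_leq _ _))// IHn.
rewrite size_scale// invr_eq0 gt_eqF// sqrtr_gt0 moment_functional_sqr_gt0//.
by rewrite -size_poly_eq0 sz.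
Qed.

Lemma orthopoly_neq0 n : P n != 0.
Proof. by rewrite -size_poly_eq0 size_orthopoly. Qed.

Lemma orthopoly_orthonormal i j : L (P i * P j) = (i == j)%:R.
Proof.
(* Induction on a common strict bound [m] of both indices: passing to [m.+1] only adds pairs that
   contain [m]. *)
suff main m : forall i j, (i < m)%N -> (j < m)%N -> L (P i * P j) = (i == j)%:R.
  by apply: (main (maxn i j).+1); rewrite ltnS ?leq_maxl ?leq_maxr.
elim: m {i j} => // m IHm.
have res_neq0 : monic_residue m != 0.
  by apply: contraNneq (orthopoly_neq0 m) => h; rewrite orthopolyE h scaler0.
have orth k : (k < m)%N -> L (P k * P m) = 0.
  move=> km; rewrite (orthopolyE m) -scalerAr moment_functionalZ.
  suff -> : L (P k * monic_residue m) = 0 by rewrite mulr0.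
  rewrite /monic_residue mulrBr moment_functionalB mulr_sumr moment_functional_sum.
  rewrite (bigD1 (Ordinal km))//= big1 => [|l lk].
    rewrite -scalerAr moment_functionalZ (IHm k k)// eqxx mulr1 addr0.
    by rewrite [P k * _]mulrC subrr.
  rewrite -scalerAr moment_functionalZ IHm//; move: lk; rewrite -val_eqE/= eq_sym.
  by move=> /negPf ->; rewrite ?mulr0n ?mulr0.
move=> i j; rewrite !ltnS leq_eqVlt => /predU1P[->|im]; rewrite leq_eqVlt => /predU1P[->|jm].
- rewrite eqxx orthopolyE -scalerAl -scalerAr !moment_functionalZ mulrA -invfM.
  have r0 := moment_functional_sqr_gt0 res_neq0.
  by rewrite -expr2 sqr_sqrtr ?ltW// mulVf// gt_eqF.
- by rewrite mulrC orth// gtn_eqF.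
- by rewrite orth// ltn_eqF.
- exact: IHm.
Qed.

Lemma orthopoly_expansion n p : (size p <= n)%N -> p = \sum_(k < n) L (p * P k) *: P k.
Proof.
(* It is enough to write [p] as some combination of the [P k]: orthonormality then identifies the
   coefficients. *)
move=> pn; suff [c pE] : exists c : nat -> R, p = \sum_(k < n) c k *: P k.
  rewrite {1}pE; apply: eq_bigr => k _; congr (_ *: _).
  rewrite pE mulr_suml moment_functional_sum (bigD1 k)//= big1 => [|l lk].
    by rewrite -scalerAl moment_functionalZ orthopoly_orthonormal eqxx mulr1 addr0.
  rewrite -scalerAl moment_functionalZ orthopoly_orthonormal.
  by move: lk; rewrite -val_eqE/= => /negPf ->; rewrite mulr0.
elim: n p pn => [|n IHn] p pn.
  exists (fun=> 0); rewrite big_ord0; apply/eqP.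
  by rewrite -size_poly_eq0 -leqn0.
pose a := p`_n / lead_coef (P n).
have [|c cE] := IHn (p - a *: P n).
  apply/leq_sizeP => j; rewrite leq_eqVlt => /predU1P[<-|nj].
    rewrite coefB coefZ /a lead_coefE size_orthopoly/= divfK ?subrr//.
    by have := orthopoly_neq0 n; rewrite -lead_coef_eq0 lead_coefE size_orthopoly.
  rewrite coefB coefZ !nth_default ?size_orthopoly// ?mulr0 ?subrr//.
  exact: leq_trans pn nj.
exists (fun k => if k == n then a else c k); rewrite big_ord_recr/= eqxx.
under eq_bigr => i _ do rewrite ltn_eqF//.
by rewrite -cE subrK.
Qed.

Lemma orthopoly_orthogonal n p : (size p <= n)%N -> L (P n * p) = 0.
Proof.
move=> /orthopoly_expansion ->; rewrite mulr_sumr moment_functional_sum big1// => k _.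
by rewrite -scalerAr moment_functionalZ orthopoly_orthonormal gtn_eqF// mulr0.
Qed.

Lemma parseval n p : (size p <= n)%N -> L (p * p) = \sum_(k < n) L (p * P k) ^+ 2.
Proof.
move=> pn; rewrite {2}(orthopoly_expansion pn) mulr_sumr moment_functional_sum.
by apply: eq_bigr => k _; rewrite -scalerAr moment_functionalZ expr2.
Qed.

End Orthonormal.
End MomentFunctional.

(** * The connecting matrix *)

Section ConnectingForms.
Variables (R : realType) (s : nat -> R).
Implicit Types p q : {poly R}.
Local Notation L := (moment_functional s).

Lemma chebTSS n : chebT n.+2 = 'X * chebT n.+1 - chebT n :> {poly R}.
Proof. by []. Qed.

(** At 2 cos x the polynomial T_n takes the value sin(n x) / sin x, and this is the linearization of
    a product of two such quotients. The recurrence has order two, so the induction carries two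
    consecutive values of [b]. *)
Lemma chebTM b d :
  chebT (b + d) * chebT b = \sum_(k < b) chebT (d + 2 * k).+1 :> {poly R}.
Proof.
suff [] : chebT (b + d) * chebT b = \sum_(k < b) chebT (d + 2 * k).+1 :> {poly R} /\
    forall d, chebT (b.+1 + d) * chebT b.+1 =
      \sum_(k < b.+1) chebT (d + 2 * k).+1 :> {poly R} by [].
elim: b d => [|b IHb] d.
  split=> [|e]; first by rewrite mulr0 big_ord0.
  by rewrite big_ord1 /= mulr1 muln0 addn0.
split=> [|e]; first exact: (IHb d).2.
(* Multiplication by X moves the index both ways, so the product for [b.+2] is two products for
   [b.+1] minus one for [b]; the two sums with shift [e.+2] cancel up to one term. *)
have hS : 'X * chebT (b.+2 + e) = chebT (b.+1 + e.+2) + chebT (b.+1 + e) :> {poly R}.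
  by rewrite -[(b.+1 + e.+2)%N]/((b + e.+2).+1) !addnS !addSn (chebTSS (b + e).+1) subrK.
rewrite [chebT b.+2]chebTSS mulrBr mulrA [chebT _ * 'X]mulrC hS mulrDl.
rewrite (IHb 0%N).2 (IHb 0%N).2 -[(b.+2 + e)%N]/((b + e).+2) -!addnS (IHb e.+2).1.
have recr n (f : nat -> {poly R}) : \sum_(k < n.+1) f k = \sum_(k < n) f k + f n.
  exact: big_ord_recr.
rewrite (recr b (fun k => chebT (e.+2 + 2 * k).+1)).
rewrite (recr b.+1 (fun k => chebT (e + 2 * k).+1)) addrAC.
rewrite [X in X - _]addrC addrK addrC; congr (_ + chebT _).
by lia.
Qed.

(** For [i <= j] the sum defining the entry is the product formula [chebTM] with [b = T - j] and
    [d = j - i], to which L is applied term by term. *)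
Lemma connecting_mxE T (i j : 'I_T) :
  connecting_mx s T i j = L (chebT (T - i) * chebT (T - j)).
Proof.
wlog ij : i j / (i <= j)%N => [hw|].
  case/orP: (leq_total i j) => [|ji]; first exact: hw.
  by rewrite [in RHS]mulrC -hw// !mxE maxnC distnC.
rewrite mxE (maxn_idPr _)// subnSK// big_mkord.
have -> : (T - i = (T - j) + (j - i))%N by have := ltn_ord j; lia.
rewrite chebTM moment_functional_sum; apply: eq_bigr => k _.
by rewrite /response; congr (L (chebT (_ + _).+1)); lia.
Qed.

Lemma size_chebT n : size (chebT n.+1 : {poly R}) = n.+1.
Proof.
suff [] : size (chebT n.+1 : {poly R}) = n.+1 /\ size (chebT n.+2 : {poly R}) = n.+2 by [].
elim: n => [|n [IH1 IH2]]; first by rewrite /= subr0 mulr1 size_polyX size_poly1.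
split=> //; rewrite chebTSS size_polyDl.
  by rewrite mulrC size_mulX ?IH2// -size_poly_eq0 IH2.
by rewrite size_polyN mulrC size_mulX -?size_poly_eq0 IH2// IH1 ltnS leqnSn.
Qed.

Lemma chebT_span n p : (size p <= n)%N ->
  exists c : nat -> R, p = \sum_(k < n) c k *: chebT k.+1.
Proof.
elim: n p => [|n IHn] p pn.
  exists (fun=> 0); rewrite big_ord0; apply/eqP.
  by rewrite -size_poly_eq0 -leqn0.
pose a := p`_n / lead_coef (chebT n.+1).
have [|c cE] := IHn (p - a *: chebT n.+1).
  apply/leq_sizeP => j; rewrite leq_eqVlt => /predU1P[<-|nj].
    rewrite coefB coefZ /a lead_coefE size_chebT/= divfK ?subrr//.
    by rewrite -[n in _`_n]/n.+1.-1 -size_chebT -lead_coefE lead_coef_eq0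
      -size_poly_eq0 size_chebT.
  rewrite coefB coefZ !nth_default ?size_chebT// ?mulr0 ?subrr//.
  exact: leq_trans pn nj.
exists (fun k => if k == n then a else c k); rewrite big_ord_recr/= eqxx.
under eq_bigr => i _ do rewrite ltn_eqF//.
by rewrite -cE subrK.
Qed.

Hypothesis s_pos : forall N : nat, posdefmx (hankelmx s N).

(* Writing the orthonormal polynomials as P = U g in the basis g_i = T_{T-i}
   gives U C U^T = 1, hence C^{-1} = U^T U. *)
Lemma connecting_form (phi : {poly R} -> R) T :
  (forall a p q, phi (a *: p + q) = a * phi p + phi q) ->
  let v := \col_(i < T) phi (chebT (T - i)) in
  dotprod (invmx (connecting_mx s T) *m v) v =
    \sum_(n < T) phi (orthopoly s n) ^+ 2.
Proof.
move=> phiL v; set C := connecting_mx s T.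
have phi0 : phi 0 = 0.
  by have := phiL 1 0 0; rewrite scale1r addr0 mul1r => /eqP; rewrite -subr_eq subrr => /eqP.
have phi_sum (c : 'I_T -> R) (g : 'I_T -> {poly R}) :
    phi (\sum_i c i *: g i) = \sum_i c i * phi (g i).
  elim/big_rec2: _ => [|i x y _ <-]; first exact: phi0.
  exact: phiL.
have /fin_all_exists[U UE] (n : 'I_T) : exists u : 'I_T -> R,
    orthopoly s n = \sum_j u j *: chebT (T - j).
  have [|c ->] := @chebT_span T (orthopoly s n); first by rewrite size_orthopoly.
  (* [chebT_span] lists T_1, ..., T_T upwards while the basis used here runs downwards, hence the
     reversal of indices. *)
  exists (fun j => c (T - j.+1)%N); rewrite (reindex_inj rev_ord_inj).
  by apply: eq_bigr => j _; congr (_ *: chebT _); rewrite /= subnSK.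
pose Umx : 'M[R]_T := \matrix_(i, j) U i j.
have UCU : Umx *m C *m Umx^T = 1%:M.
  apply/matrixP => i j; rewrite !mxE -val_eqE/=.
  rewrite -(orthopoly_orthonormal s_pos) (UE i) (UE j) mulr_sumr moment_functional_sum.
  apply: eq_bigr => l _; rewrite -scalerAr moment_functionalZ [Umx^T _ _]mxE.
  rewrite [Umx j l]mxE mulrC mxE; congr (_ * _).
  rewrite mulr_suml moment_functional_sum; apply: eq_bigr => k _.
  by rewrite [Umx i k]mxE connecting_mxE -scalerAl moment_functionalZ.
have CUU : C *m (Umx^T *m Umx) = 1%:M.
  by apply: mulmx1C; rewrite -mulmxA; apply: mulmx1C.
have invC : invmx C = Umx^T *m Umx.
  have [Cu _] := mulmx1_unit CUU.
  by rewrite -[LHS]mulmx1 -CUU (mulmxA (invmx C)) mulVmx// mul1mx.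
have dotE (x y : 'cV[R]_T) : dotprod x y = (x^T *m y) 0 0.
  by rewrite mxE; apply: eq_bigr => i _; rewrite mxE.
rewrite dotE invC -mulmxA trmx_mul trmxK -mulmxA -dotE; apply: eq_bigr => n _.
have Uv : (Umx *m v) n 0 = phi (orthopoly s n).
  by rewrite mxE UE phi_sum; apply: eq_bigr => j _; rewrite !mxE.
by rewrite Uv expr2.
Qed.

Lemma connecting_form_Gamma T :
  dotprod (invmx (connecting_mx s T) *m Gamma_vec T) (Gamma_vec T) =
  \sum_(n < T) (orthopoly s n).[0] ^+ 2.
Proof.
by apply: (@connecting_form (fun p => p.[0])) => a p q; rewrite hornerD hornerZ.
Qed.

Lemma connecting_form_Omega T :
  dotprod (invmx (connecting_mx s T) *m Omega_vec T) (Omega_vec T) =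
  \sum_(n < T) (orthopoly s n)^`().[0] ^+ 2.
Proof.
apply: (@connecting_form (fun p => p^`().[0])) => a p q.
by rewrite derivD derivZ hornerD hornerZ.
Qed.

End ConnectingForms.

(** * Hilbert-Schmidt quotients *)

Section SquareSummable.
Variable R : realType.
Implicit Types (u v x : nat -> R) (M : nat -> nat -> R).

Definition square_summable u := exists B, forall N, \sum_(n < N) u n ^+ 2 <= B.

(* Only the strictly lower triangular entries of M count. *)
Definition hilbert_schmidt M :=
  exists B, forall N, \sum_(n < N) \sum_(k < n) M n k ^+ 2 <= B.

(** Lagrange's identity: the sum of the squared 2x2 minors is twice the difference of the two
    sides. *)
Lemma cauchy_schwarz_sum n (a b : 'I_n -> R) :
  (\sum_i a i * b i) ^+ 2 <= (\sum_i a i ^+ 2) * (\sum_i b i ^+ 2).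
Proof.
suff E : \sum_i \sum_j (a i * b j - a j * b i) ^+ 2 =
    2 * ((\sum_i a i ^+ 2) * (\sum_i b i ^+ 2)) - 2 * (\sum_i a i * b i) ^+ 2.
  have : 0 <= \sum_i \sum_j (a i * b j - a j * b i) ^+ 2.
    by apply: sumr_ge0 => i _; apply: sumr_ge0 => j _; exact: sqr_ge0.
  by rewrite E; lra.
have -> : 2 * ((\sum_i a i ^+ 2) * (\sum_i b i ^+ 2)) =
    \sum_i \sum_j (a i ^+ 2 * b j ^+ 2) + \sum_i \sum_j (a j ^+ 2 * b i ^+ 2).
  rewrite [X in _ = _ + X]exchange_big/= -mulr2n mulr_natl; congr (_ *+ _).
  by rewrite mulr_suml; apply: eq_bigr => i _; rewrite mulr_sumr.
rewrite expr2 mulr_suml mulr_sumr -sumrN -!big_split/=; apply: eq_bigr => i _.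
rewrite mulr_sumr mulr_sumr -sumrN -!big_split/=; apply: eq_bigr => j _.
by ring.
Qed.

Lemma eq_square_summable u v : u =1 v -> square_summable u -> square_summable v.
Proof. by move=> /funext ->. Qed.

Lemma square_summableD u v : square_summable u -> square_summable v ->
  square_summable (fun n => u n + v n).
Proof.
move=> [B uB] [C vC]; exists (2 * B + 2 * C) => N.
apply: (@le_trans _ _ (2 * \sum_(n < N) u n ^+ 2 + 2 * \sum_(n < N) v n ^+ 2)).
  rewrite !mulr_sumr -big_split/=; apply: ler_sum => n _.
  by have := sqr_ge0 (u n - v n); lra.
by have := uB N; have := vC N; lra.
Qed.

Lemma square_summableZ c u : square_summable u -> square_summable (fun n => c * u n).
Proof.
move=> [B uB]; exists (c ^+ 2 * B) => N.
under eq_bigr do rewrite exprMn.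
by rewrite -mulr_sumr ler_wpM2l ?sqr_ge0.
Qed.

Lemma square_summableB u v : square_summable u -> square_summable v ->
  square_summable (fun n => u n - v n).
Proof.
move=> su /(square_summableZ (-1)) sv.
by apply: eq_square_summable (square_summableD su sv) => n; rewrite mulN1r.
Qed.

Lemma square_summable_sum d (u : nat -> nat -> R) :
  (forall i, (i < d)%N -> square_summable (u i)) ->
  square_summable (fun n => \sum_(i < d) u i n).
Proof.
elim: d => [_|d IHd ud].
  by exists 0 => N; rewrite big1// => n _; rewrite big_ord0 expr0n.
have ud' i : (i < d)%N -> square_summable (u i) by move=> id; apply: ud; exact: ltnW.
apply: eq_square_summable (square_summableD (IHd ud') (ud d (ltnSn d))) => n.
by rewrite big_ord_recr.
Qed.

Lemma eq_hilbert_schmidt M M' : (forall n k, (k < n)%N -> M n k = M' n k) ->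
  hilbert_schmidt M -> hilbert_schmidt M'.
Proof.
move=> MM' [B MB]; exists B => N; apply: le_trans (MB N).
apply: ler_sum => n _; apply: ler_sum => k _.
by rewrite MM'// lexx.
Qed.

Lemma hilbert_schmidtD M M' : hilbert_schmidt M -> hilbert_schmidt M' ->
  hilbert_schmidt (fun n k => M n k + M' n k).
Proof.
move=> [B MB] [C MC]; exists (2 * B + 2 * C) => N.
apply: (@le_trans _ _ (2 * \sum_(n < N) \sum_(k < n) M n k ^+ 2 +
                       2 * \sum_(n < N) \sum_(k < n) M' n k ^+ 2)).
  rewrite !mulr_sumr -big_split/=; apply: ler_sum => n _.
  rewrite !mulr_sumr -big_split/=; apply: ler_sum => k _.
  by have := sqr_ge0 (M n k - M' n k); lra.
by have := MB N; have := MC N; lra.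
Qed.

Lemma hilbert_schmidtZ c M : hilbert_schmidt M ->
  hilbert_schmidt (fun n k => c * M n k).
Proof.
move=> [B MB]; exists (c ^+ 2 * B) => N.
apply: le_trans (ler_wpM2l (sqr_ge0 c) (MB N)).
rewrite mulr_sumr; apply: ler_sum => n _; rewrite mulr_sumr.
by apply: ler_sum => k _; rewrite exprMn.
Qed.

Lemma hilbert_schmidtB M M' : hilbert_schmidt M -> hilbert_schmidt M' ->
  hilbert_schmidt (fun n k => M n k - M' n k).
Proof.
move=> hM /(hilbert_schmidtZ (-1)) hM'.
by apply: eq_hilbert_schmidt (hilbert_schmidtD hM hM') => n k _; rewrite mulN1r.
Qed.

Lemma hilbert_schmidt_sum d (M : nat -> nat -> nat -> R) :
  (forall i, (i < d)%N -> hilbert_schmidt (M i)) ->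
  hilbert_schmidt (fun n k => \sum_(i < d) M i n k).
Proof.
elim: d => [_|d IHd Md].
  by exists 0 => N; rewrite big1// => n _; rewrite big1// => k _; rewrite big_ord0 expr0n.
have Md' i : (i < d)%N -> hilbert_schmidt (M i) by move=> id; apply: Md; exact: ltnW.
apply: eq_hilbert_schmidt (hilbert_schmidtD (IHd Md') (Md d (ltnSn d))) => n k _.
by rewrite big_ord_recr.
Qed.

Lemma hilbert_schmidt_tensor u v : square_summable u -> square_summable v ->
  hilbert_schmidt (fun n k => u n * v k).
Proof.
move=> [B uB] [C vC]; exists (B * C) => N.
have C0 : 0 <= C by have := vC 0%N; rewrite big_ord0.
apply: (@le_trans _ _ (\sum_(n < N) u n ^+ 2 * C)).
  apply: ler_sum => n _; under eq_bigr do rewrite exprMn.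
  by rewrite -mulr_sumr ler_wpM2l ?sqr_ge0.
by rewrite -mulr_suml ler_wpM2r.
Qed.

Lemma square_summable_apply M x : hilbert_schmidt M -> square_summable x ->
  square_summable (fun n => \sum_(k < n) M n k * x k).
Proof.
move=> [B MB] [C xC]; exists (B * C) => N.
have C0 : 0 <= C by have := xC 0%N; rewrite big_ord0.
apply: (@le_trans _ _ (\sum_(n < N) (\sum_(k < n) M n k ^+ 2) * C)).
  apply: ler_sum => n _.
  apply: le_trans (cauchy_schwarz_sum (fun k : 'I_n => M n k) (fun k => x k)) _.
  by rewrite ler_wpM2l// sumr_ge0// => k _; exact: sqr_ge0.
by rewrite -mulr_suml ler_wpM2r.
Qed.

Lemma discrete_gronwall (x2 a m : nat -> R) A H :
  (forall n, 0 <= a n) -> (forall n, 0 <= m n) ->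
  (forall n, 0 <= x2 n) ->
  (forall n, x2 n <= a n + m n * \sum_(k < n) x2 k) ->
  (forall N, \sum_(n < N) a n <= A) -> (forall N, \sum_(n < N) m n <= H) ->
  forall N, \sum_(n < N) x2 n <= A * expR H.
Proof.
move=> a0 m0 x0 xle aA mH N.
(* The induction needs the bound with partial sums in place of [A] and [H]. One step replaces the
   sum X by at most X (1 + m_N) + a_N, and 1 + m <= exp m absorbs the first factor. *)
suff : \sum_(n < N) x2 n <= (\sum_(n < N) a n) * expR (\sum_(n < N) m n).
  move=> /le_trans; apply; by rewrite ler_pM ?expR_ge0 ?ler_expR ?sumr_ge0.
elim: N => [|N IHN]; first by rewrite !big_ord0 mul0r.
rewrite !big_ord_recr/= expRD.
set X := \sum_(k < N) x2 k in IHN *; set E := expR _ in IHN *.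
have X0 : 0 <= X by apply: sumr_ge0.
have E1 : 1 <= E by rewrite -expR0 ler_expR; exact: sumr_ge0.
have S0 : 0 <= \sum_(k < N) a k by apply: sumr_ge0.
apply: (@le_trans _ _ (X * (1 + m N) + a N)).
  by rewrite mulrDr mulr1 -addrA lerD2l addrC mulrC; exact: xle.
have e1 := expR_ge1Dx (m N).
have e0 : 1 <= expR (m N) by apply: le_trans e1; rewrite lerDl.
rewrite mulrDl; apply: lerD.
  rewrite mulrA; apply: ler_pM => //; rewrite addr_ge0//.
rewrite -[leLHS]mulr1 ler_wpM2l// -[leLHS]mulr1.
by apply: ler_pM.
Qed.

(** Squaring the equation and applying Cauchy-Schwarz to each row gives a Gronwall inequality with
    weights twice the squared row norms. The explicit constant depends on [B] and [U] only, which is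
    what makes [evaluation_bound] uniform. *)
Lemma square_summable_volterra_bound M u x B U :
  (forall N, \sum_(n < N) \sum_(k < n) M n k ^+ 2 <= B) ->
  (forall N, \sum_(n < N) u n ^+ 2 <= U) ->
  (forall n, x n = u n + \sum_(k < n) M n k * x k) ->
  forall N, \sum_(n < N) x n ^+ 2 <= 2 * U * expR (2 * B).
Proof.
move=> MB uU xE.
apply: (@discrete_gronwall (fun n => x n ^+ 2) (fun n => 2 * u n ^+ 2)
  (fun n => 2 * \sum_(k < n) M n k ^+ 2)).
- by move=> n; rewrite mulr_ge0// sqr_ge0.
- by move=> n; rewrite mulr_ge0// sumr_ge0// => k _; exact: sqr_ge0.
- by move=> n; exact: sqr_ge0.
- move=> n; rewrite {1}xE.
  have := cauchy_schwarz_sum (fun k : 'I_n => M n k) (fun k => x k).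
  set c := \sum_(k < n) _ * _.
  by have := sqr_ge0 (u n - c); lra.
- by move=> N; rewrite -mulr_sumr ler_wpM2l.
- by move=> N; rewrite -mulr_sumr ler_wpM2l.
Qed.

Lemma square_summable_volterra M u x : hilbert_schmidt M -> square_summable u ->
  (forall n, x n = u n + \sum_(k < n) M n k * x k) -> square_summable x.
Proof.
move=> [B MB] [U uU] xE; exists (2 * U * expR (2 * B)).
exact: square_summable_volterra_bound xE.
Qed.

End SquareSummable.

(** * Division by a fixed polynomial in the orthonormal basis *)

Section Quotient.
Variables (R : realType) (s : nat -> R).
Hypothesis s_pos : forall N : nat, posdefmx (hankelmx s N).
Variable w : {poly R}.
Hypothesis size_w : (1 < size w)%N.
Implicit Types p q : {poly R}.
Local Notation L := (moment_functional s).
Local Notation P := (orthopoly s).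
Local Notation d := (size w).-1.

Definition quotient_mx n k := L ((P n %/ w) * P k).

Let w_neq0 : w != 0.
Proof. by rewrite -size_poly_gt0 (ltn_trans _ size_w). Qed.

Let size_rem p : (size (p %% w)%R <= d)%N.
Proof.
rewrite -ltnS prednK; last exact: ltn_trans size_w.
exact: (etrans (ltn_modp p w) w_neq0).
Qed.

Lemma size_orthopoly_div n : (size (P n %/ w)%R <= n)%N.
Proof.
rewrite size_divp// size_orthopoly//; move: size_w; case: (size w) => [|[|m]]//= _.
by rewrite subSS leq_subr.
Qed.

Lemma moment_functional_modp p q :
  L (q * (p %% w)) = \sum_(i < d) (p %% w)`_i * L ('X^i * q).
Proof.
rewrite {1}(poly_sum_coefXn (size_rem p)) mulr_sumr moment_functional_sum; apply: eq_bigr => i _.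
by rewrite -scalerAr moment_functionalZ mulrC [q * _]mulrC mulrC.
Qed.

(* Symmetry of L makes the quotient by w skew up to the remainders, while
   P_n is orthogonal to the quotient of P_k. *)
Lemma quotient_mxE n k : (k < n)%N ->
  quotient_mx n k = \sum_(i < d) L ('X^i * (P n %/ w)) * (P k %% w)`_i -
                    \sum_(i < d) (P n %% w)`_i * L ('X^i * (P k %/ w)).
Proof.
move=> kn; rewrite -moment_functional_modp.
under eq_bigr do rewrite mulrC.
rewrite -moment_functional_modp /quotient_mx.
have {1}-> : P k = P k %/ w * w + P k %% w by exact: divp_eq.
rewrite mulrDr moment_functionalD addrC; congr (_ + _).
have -> : P n %/ w * (P k %/ w * w) = P n * (P k %/ w) - P k %/ w * (P n %% w).
  by rewrite {2}(divp_eq (P n) w); ring.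
rewrite moment_functionalB orthopoly_orthogonal// ?sub0r//.
by rewrite (leq_trans (size_orthopoly_div _))// ltnW.
Qed.

(** Below the diagonal, [quotient_mxE] expresses the matrix as a finite sum of products of a square
    summable sequence in [n] and one in [k]. *)
Lemma quotient_hilbert_schmidt :
  (forall i, (i < d)%N -> square_summable (fun n => (P n %% w)`_i)) ->
  (forall i, (i < d)%N -> square_summable (fun n => L ('X^i * (P n %/ w)))) ->
  hilbert_schmidt quotient_mx.
Proof.
move=> hr hq; apply: (eq_hilbert_schmidt (fun n k kn => esym (quotient_mxE kn))).
apply: hilbert_schmidtB.
  apply: (@hilbert_schmidt_sum _ _ (fun i n k => L ('X^i * (P n %/ w)) * (P k %% w)`_i)).
  by move=> i id; apply: hilbert_schmidt_tensor; [exact: hq|exact: hr].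
apply: (@hilbert_schmidt_sum _ _ (fun i n k => (P n %% w)`_i * L ('X^i * (P k %/ w)))).
by move=> i id; apply: hilbert_schmidt_tensor; [exact: hr|exact: hq].
Qed.

(** The quotient has degree less than [n], so only earlier polynomials occur in its expansion.
    Evaluating this identity and its derivative at a point yields discrete Volterra equations. *)
Lemma orthopoly_quotient n :
  P n = P n %% w + w * \sum_(k < n) quotient_mx n k *: P k.
Proof.
rewrite -orthopoly_expansion ?size_orthopoly_div//.
by rewrite {1}(divp_eq (P n) w) addrC mulrC.
Qed.

Lemma horner_orthopoly t n :
  (P n).[t] = (P n %% w).[t] + \sum_(k < n) (w.[t] * quotient_mx n k) * (P k).[t].
Proof.
rewrite {1}orthopoly_quotient hornerD hornerM horner_sum mulr_sumr.
by congr (_ + _); apply: eq_bigr => k _; rewrite hornerZ mulrA.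
Qed.

Lemma horner_deriv_orthopoly t n :
  (P n)^`().[t] = ((P n %% w)^`().[t] +
      w^`().[t] * \sum_(k < n) quotient_mx n k * (P k).[t]) +
    \sum_(k < n) (w.[t] * quotient_mx n k) * (P k)^`().[t].
Proof.
rewrite {1}orthopoly_quotient derivD derivM 2!hornerD !hornerM horner_sum.
rewrite raddf_sum/= horner_sum -addrA; congr (_ + (_ * _ + _)).
  by apply: eq_bigr => k _; rewrite hornerZ.
by rewrite mulr_sumr; apply: eq_bigr => k _; rewrite derivZ hornerZ mulrA.
Qed.

Hypothesis rem_summable :
  forall i, (i < d)%N -> square_summable (fun n => (P n %% w)`_i).
Hypothesis quo_summable :
  forall i, (i < d)%N -> square_summable (fun n => L ('X^i * (P n %/ w))).

Lemma square_summable_horner t : square_summable (fun n => (P n).[t]).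
Proof.
apply: (@square_summable_volterra _ (fun n k => w.[t] * quotient_mx n k) _ _ _ _
  (horner_orthopoly t)).
  exact/hilbert_schmidtZ/quotient_hilbert_schmidt.
apply: (@eq_square_summable _ (fun n => \sum_(i < d) t ^+ i * (P n %% w)`_i)).
  move=> n; rewrite (horner_coef_wide _ (size_rem (P n))).
  by apply: eq_bigr => i _; rewrite mulrC.
by apply: (@square_summable_sum _ _ (fun i n => t ^+ i * (P n %% w)`_i)) => i id;
  exact/square_summableZ/rem_summable.
Qed.

Lemma square_summable_horner_deriv t : square_summable (fun n => (P n)^`().[t]).
Proof.
have HS := quotient_hilbert_schmidt rem_summable quo_summable.
apply: (@square_summable_volterra _ (fun n k => w.[t] * quotient_mx n k) _ _ _ _
  (horner_deriv_orthopoly t)).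
  exact/hilbert_schmidtZ.
(* The inhomogeneous term has two parts: the derivative of the remainder, and the Hilbert-Schmidt
   matrix applied to the values at [t], which are already known to be square summable. *)
apply: square_summableD; last first.
  by apply: square_summableZ; apply: (square_summable_apply HS (square_summable_horner t)).
apply: (@eq_square_summable _
    (fun n => \sum_(i < d) (i%:R * t ^+ i.-1) * (P n %% w)`_i)).
  move=> n; rewrite [in RHS](poly_sum_coefXn (size_rem (P n))) raddf_sum/= horner_sum.
  apply: eq_bigr => i _.
  by rewrite derivZ derivXn hornerZ hornerMn hornerXn mulr_natl mulrC.
by apply: (@square_summable_sum _ _ (fun i n => (i%:R * t ^+ i.-1) * (P n %% w)`_i))
  => i id; exact/square_summableZ/rem_summable.
Qed.

End Quotient.

(** * Uniform bound for point evaluations *)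

Section EvaluationBound.
Variables (R : realType) (s : nat -> R).
Hypothesis s_pos : forall N : nat, posdefmx (hankelmx s N).
Implicit Types p q : {poly R}.
Local Notation L := (moment_functional s).
Local Notation P := (orthopoly s).
Local Notation Q n := (L (P n %/ 'X)).

Let size_X : (1 < size ('X : {poly R}))%N. Proof. by rewrite size_polyX. Qed.

Lemma modp_X p : p %% 'X = p.[0]%:P.
Proof. by rewrite -['X]subr0 -polyC0 modp_XsubC. Qed.

Lemma quotient_mx_X n k : (k < n)%N ->
  quotient_mx s 'X n k = Q n * (P k).[0] - (P n).[0] * Q k.
Proof.
move=> kn; rewrite quotient_mxE// size_polyX !big_ord1 !modp_X !coefC eqxx.
by rewrite !expr0 !mul1r.
Qed.

(** For w = X the Volterra term carries the factor w(0) = 0 and the remainder is constant, so only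
    the quotient matrix applied to the values at 0 is left. *)
Lemma deriv_orthopoly0 n : (P n)^`().[0] = Q n * \sum_(k < n) (P k).[0] ^+ 2 -
  (P n).[0] * \sum_(k < n) Q k * (P k).[0].
Proof.
rewrite (horner_deriv_orthopoly s_pos size_X) modp_X derivC derivX !hornerC hornerX.
rewrite add0r mul1r [X in _ + X]big1 ?addr0; last by move=> i _; rewrite !mul0r.
rewrite !mulr_sumr -sumrB; apply: eq_bigr => k _.
by rewrite quotient_mx_X//; ring.
Qed.

(* In the previous identity the factor of Q n is at least (P 0).[0] ^+ 2 > 0, so
   Q n is controlled by its predecessors. *)
Lemma square_summable_quotient_X :
  square_summable (fun n => (P n).[0]) -> square_summable (fun n => (P n)^`().[0]) ->
  square_summable (fun n => Q n).
Proof.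
move=> [A PA] [D PD].
have [a a0 aE] : exists2 a, 0 < a & a = (P 0).[0] ^+ 2.
  have sz := size_orthopoly s_pos 0.
  exists ((P 0).[0] ^+ 2) => //.
  rewrite exprn_even_gt0//= horner_coef0 -[_`_0]/((P 0)`_(1.-1)) -[1%N]sz -lead_coefE.
  by rewrite lead_coef_eq0 orthopoly_neq0.
have A0 : 0 <= A by have := PA 0%N; rewrite big_ord0.
have c0 : 0 <= 2 / a ^+ 2 by exact: divr_ge0 (ler0n R 2) (sqr_ge0 a).
have c1 : 0 <= 2 * A / a ^+ 2.
  by exact: divr_ge0 (mulr_ge0 (ler0n R 2) A0) (sqr_ge0 a).
exists (2 / a ^+ 2 * D * expR (2 * A / a ^+ 2 * A)).
apply: (@discrete_gronwall _ (fun n => Q n ^+ 2)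
  (fun n => 2 / a ^+ 2 * (P n)^`().[0] ^+ 2) (fun n => 2 * A / a ^+ 2 * (P n).[0] ^+ 2)).
- by move=> n; exact: mulr_ge0 c0 (sqr_ge0 _).
- by move=> n; exact: mulr_ge0 c1 (sqr_ge0 _).
- by move=> n; exact: sqr_ge0.
(* The index 0 is separate: the empty sum has no lower bound [a], but the quotient of the constant
   P_0 by X is zero. *)
- case=> [|n].
    have -> : P 0 %/ 'X = 0.
      apply/eqP; rewrite -size_poly_eq0 -leqn0.
      exact: size_orthopoly_div.
    rewrite moment_functional0 expr0n/= big_ord0 mulr0 addr0.
    exact: mulr_ge0 c0 (sqr_ge0 _).
  set m := n.+1; set S := \sum_(k < m) (Q k) ^+ 2.
  have aS : a <= \sum_(k < m) (P k).[0] ^+ 2.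
    by rewrite aE /m big_ord_recl lerDl sumr_ge0// => k _; exact: sqr_ge0.
  have CS : (\sum_(k < m) Q k * (P k).[0]) ^+ 2 <= S * A.
    apply: le_trans (cauchy_schwarz_sum (fun k : 'I_m => Q k) (fun k => (P k).[0])) _.
    by rewrite ler_wpM2l// sumr_ge0// => k _; exact: sqr_ge0.
  have S0 : 0 <= S by apply: sumr_ge0 => k _; exact: sqr_ge0.
  have := deriv_orthopoly0 m.
  move: aS CS; set b := \sum_(k < m) _; set c := \sum_(k < m) _ => aS CS E.
  (* Isolate the term with [Q m] in [deriv_orthopoly0], square it, and bound its factor below by [a]
     and the other sum by Cauchy-Schwarz. Division by [a ^+ 2] produces the constants given to
     Gronwall. *)
  have main : a ^+ 2 * Q m ^+ 2 <=
      2 * (P m)^`().[0] ^+ 2 + 2 * A * (P m).[0] ^+ 2 * S.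
    apply: (@le_trans _ _ ((Q m * b) ^+ 2)).
      rewrite exprMn [leRHS]mulrC ler_wpM2r ?sqr_ge0// ler_sqr ?nnegrE ?(ltW a0)//.
      exact: le_trans (ltW a0) aS.
    have -> : Q m * b = (P m)^`().[0] + (P m).[0] * c by rewrite E; ring.
    have h1 := sqr_ge0 ((P m)^`().[0] - (P m).[0] * c).
    have := ler_wpM2l (sqr_ge0 (P m).[0]) CS.
    lra.
  rewrite -(ler_pM2l (exprn_gt0 2 a0)); apply: le_trans main _.
  rewrite le_eqVlt; apply/orP; left; apply/eqP.
  by field; rewrite gt_eqF.
- by move=> N; rewrite -mulr_sumr ler_wpM2l.
- by move=> N; rewrite -mulr_sumr ler_wpM2l.
Qed.

(** Expand p in the orthonormal basis: by Cauchy-Schwarz and Parseval, p(t)^2 is at most L(p^2)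
    times the sum of the P_n(t)^2, and the Volterra bound controls this sum uniformly in t. *)
Lemma evaluation_bound :
  square_summable (fun n => (P n).[0]) -> square_summable (fun n => (P n)^`().[0]) ->
  exists2 M : R, 0 < M & forall t p, 0 <= t <= 1 -> p.[t] ^+ 2 <= M * L (p * p).
Proof.
move=> sP sP'; have sQ := square_summable_quotient_X sP sP'.
have [||B HB] := @quotient_hilbert_schmidt _ s s_pos 'X size_X.
- move=> i; rewrite size_polyX ltnS leqn0 => /eqP ->.
  by apply: eq_square_summable sP => n; rewrite modp_X coefC.
- move=> i; rewrite size_polyX ltnS leqn0 => /eqP ->.
  by apply: eq_square_summable sQ => n; rewrite expr0 mul1r.
have [A PA] := sP.
pose M := 2 * A * expR (2 * B).
have PM t N : 0 <= t <= 1 -> \sum_(n < N) (P n).[t] ^+ 2 <= M.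
  move=> /andP[t0 t1].
  apply: (@square_summable_volterra_bound _ (fun n k => t * quotient_mx s 'X n k)
    (fun n => (P n).[0]) (fun n => (P n).[t])) => //.
  (* Since 0 <= t <= 1, the factor t^2 does not increase the Hilbert-Schmidt bound; the constant is
     therefore the same for all t. *)
  - move=> K; apply: le_trans (HB K).
    apply: ler_sum => n _; apply: ler_sum => k _.
    by rewrite exprMn ler_piMl ?sqr_ge0// expr_le1.
  - by move=> n; rewrite (horner_orthopoly s_pos size_X) modp_X hornerC hornerX.
exists (`|M| + 1) => [|t p t01]; first by rewrite ltr_wpDl.
rewrite {1}(orthopoly_expansion s_pos (leqnn (size p))) horner_sum.
under eq_bigr do rewrite hornerZ.
apply: le_trans (cauchy_schwarz_sum _ _) _.
rewrite -parseval// mulrC ler_wpM2r ?moment_functional_sqr_ge0//.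
apply: le_trans (PM t _ t01) _.
by rewrite (le_trans (ler_norm _))// lerDl.
Qed.

End EvaluationBound.

(** * Existence of a representing measure *)

Section SumOfSquares.
Variable R : realType.
Implicit Types p q : {poly R}.

Lemma poly_coercive p (C : R) : (1 < size p)%N ->
  exists2 B, 0 < B & forall x, B <= `|x| -> C <= `|p.[x]|.
Proof.
move=> sp; pose c := `|lead_coef p|; pose n := (size p).-2.
have szE : size p = n.+2 by rewrite /n; move: sp; case: (size p) => [|[|]].
have c0 : 0 < c by rewrite normr_gt0 lead_coef_eq0 -size_poly_gt0 szE.
pose K := \sum_(i < n.+1) `|p`_i|.
have K0 : 0 <= K by apply: sumr_ge0.
(* For |x| >= 1 the lower terms are at most K |x|^n, so |p(x)| >= |x|^n (c |x| - K); this choice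
   makes the last factor at least |C|. *)
exists (1 + (K + `|C|) / c) => [|x]; first by rewrite ltr_pwDl// divr_ge0 ?addr_ge0// ltW.
move=> xB; have x1 : 1 <= `|x|.
  by apply: le_trans xB; rewrite lerDl divr_ge0 ?addr_ge0// ltW.
have hK : K + `|C| <= c * `|x|.
  rewrite mulrC -ler_pdivrMr//; apply: le_trans xB.
  by rewrite lerDr.
have xn1 : 1 <= `|x| ^+ n by rewrite exprn_ege1.
have xn : 0 <= `|x| ^+ n by exact: le_trans ler01 xn1.
apply: le_trans (ler_norm _) _.
apply: (@le_trans _ _ (`|x| ^+ n * (c * `|x| - K))).
  rewrite -[leLHS]mul1r ler_pM//.
  by rewrite lerBrDr addrC.
rewrite horner_coef szE big_ord_recr/=.
rewrite -[p`_n.+1]/(p`_n.+2.-1) -szE -lead_coefE addrC.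
apply: le_trans (lerB_normD _ _); rewrite normrM normrX mulrBr lerB//.
  by rewrite -/c exprS [in leLHS]mulrC -mulrA lexx.
apply: le_trans (ler_norm_sum _ _ _) _; rewrite mulrC mulr_suml.
apply: ler_sum => i _; rewrite normrM normrX ler_wpM2l// ler_weXn2l//.
by rewrite -ltnS.
Qed.

(** Coercivity gives values at least p(0) outside a compact interval around 0, so the minimum on
    that interval is global. *)
Lemma poly_ge0_min p : (1 < size p)%N -> (forall x, 0 <= p.[x]) ->
  exists x0, forall x, p.[x0] <= p.[x].
Proof.
move=> sp p0; have [B B0 pB] := poly_coercive p.[0] sp.
have [||x0 x0B minx0] := @EVT_min _ (horner p) (- B) B.
- by rewrite ge0_cp// ltW.
- by apply: derivable_within_continuous => x _; exact: derivable_horner.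
exists x0 => x; have [xB|/ltW Bx] := lerP `|x| B.
  by apply: minx0; rewrite in_itv/= -ler_norml.
apply: le_trans (minx0 0 _) _; first by rewrite in_itv/= oppr_le0 ltW.
by rewrite -[leRHS]ger0_norm// pB.
Qed.

Lemma poly_ge0_off p x0 : (forall x, x != x0 -> 0 <= p.[x]) -> forall x, 0 <= p.[x].
Proof.
move=> h x; have [->|/h//] := eqVneq x x0.
have cp : p.[x] @[x --> x0^'] --> p.[x0].
  by apply: cvg_within_filter; exact/differentiable_continuous/derivable1_diffP/derivable_horner.
apply: (cvgr_to_ge cp); near=> y; apply: h; near: y.
exact: nbhs_dnbhs_neq.
Unshelve. all: end_near. Qed.

(** A root of a nonnegative polynomial is a minimum, so the derivative vanishes there and the root
    is double. The cofactor is nonnegative away from [x0], hence everywhere by continuity. *)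
Lemma poly_ge0_root_sqr p x0 : (forall x, 0 <= p.[x]) -> p.[x0] = 0 ->
  exists2 r, p = ('X - x0%:P) ^+ 2 * r & forall x, 0 <= r.[x].
Proof.
move=> p0 px0; have /factor_theorem[q pE] : root p x0 by apply/rootP.
have px0' : p^`().[x0] = 0.
  have x0I : x0 \in `](x0 - 1), (x0 + 1)[ by rewrite in_itv/= ltrBlDr ltrDl ltr01.
  have I : x0 - 1 <= x0 + 1 by rewrite lerBlDr -addrA lerDl.
  have : is_derive x0 1 (horner p) 0.
    apply: (derive1_at_min I _ x0I) => t _; last by rewrite px0.
    exact: derivable_horner.
  by move=> dp; rewrite -(@derive_val _ _ _ _ _ _ _ (is_derive_poly p x0)) derive_val.
have /factor_theorem[r qE] : root q x0.
  apply/rootP; move: px0'; rewrite pE derivM derivXsubC mulr1 hornerD hornerM.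
  by rewrite hornerXsubC subrr mulr0 add0r.
exists r; first by rewrite pE qE; ring.
apply: (@poly_ge0_off _ x0) => x xx0.
have := p0 x; rewrite pE qE -mulrA -expr2 hornerM horner_exp hornerXsubC.
by rewrite pmulr_lge0// exprn_even_gt0// subr_eq0.
Qed.

(** Subtract the minimum, which is the square of a constant; the rest has a double root, and its
    cofactor is a sum of squares by induction on the size. *)
Lemma poly_ge0_sum_sqr p : (forall x, 0 <= p.[x]) ->
  exists f : seq {poly R}, p = \sum_(g <- f) g * g.
Proof.
have [n] := ubnP (size p); elim: n p => // n IHn p sp p0.
have [sp1|sp1] := leqP (size p) 1.
  exists [:: (Num.sqrt p`_0)%:P]; rewrite big_seq1 -polyCM -expr2 sqr_sqrtr.
    exact: size1_polyC.
  by rewrite -horner_coef0.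
have [x0 minx0] := poly_ge0_min sp1 p0.
have [||r pE r0] := @poly_ge0_root_sqr (p - (p.[x0])%:P) x0.
- by move=> x; rewrite hornerD hornerN hornerC subr_ge0.
- by rewrite hornerD hornerN hornerC subrr.
have [||f rE] := IHn r => //.
  have [->|rn0] := eqVneq r 0; first by rewrite size_poly0; case: (n) sp sp1 => //; case: (size p).
  rewrite -ltnS; apply: leq_trans sp.
  have -> : size p = size (p - (p.[x0])%:P).
    by rewrite size_polyDl// size_polyN (leq_ltn_trans (size_polyC_leq1 _)).
  rewrite pE size_monicM ?monic_exp ?monicXsubC//.
  by rewrite size_exp_XsubC addnC addn3/= ltnW.
exists ((Num.sqrt p.[x0])%:P :: [seq ('X - x0%:P) * g | g <- f]).
rewrite big_cons big_map -polyCM -expr2 sqr_sqrtr// -[LHS](subrK (p.[x0])%:P) pE addrC.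
congr (_ + _); rewrite {1}rE mulr_sumr; apply: eq_bigr => g _.
by ring.
Qed.

(** Passes from positivity on squares to positivity on nonnegative polynomials, the hypothesis of
    [riesz_extension]. *)
Lemma psd_functional_ge0 s p :
  (forall q, 0 <= moment_functional s (q * q)) -> (forall x, 0 <= p.[x]) ->
  0 <= moment_functional s p.
Proof.
move=> L0 /poly_ge0_sum_sqr[f ->].
by rewrite moment_functional_sum sumr_ge0.
Qed.

End SumOfSquares.

(** * M. Riesz extension of positive functionals *)

Section RieszExtension.
Variable R : realType.
Implicit Types (p q : {poly R}) (f g h : R -> R).

Definition poly_dominated f := exists q, forall x, `|f x| <= q.[x].

Variable L : {poly R} -> R.
Hypothesis L_linear : forall a p q, L (a *: p + q) = a * L p + L q.
Hypothesis L_ge0 : forall p, (forall x, 0 <= p.[x]) -> 0 <= L p.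

Let poly_graph : set ((R -> R) * R) := [set (horner p, L p) | p in setT].

Let comb (a : R) (u v : (R -> R) * R) : (R -> R) * R :=
  (fun x => a * u.1 x + v.1 x, a * u.2 + v.2).

(** A positive linear functional on a space of functions, encoded by its graph so that extensions
    are inclusions. Positivity applied to the zero function, in both directions, makes the graph
    single-valued. *)
Let positive_graph (G : set ((R -> R) * R)) :=
  [/\ poly_graph `<=` G, (forall a u v, G u -> G v -> G (comb a u v))
    & forall u, G u -> (forall x, 0 <= u.1 x) -> 0 <= u.2].

Let poly_graph_positive : positive_graph poly_graph.
Proof.
split=> // [a _ _ [p _ <-] [q _ <-]|_ [p _ <-]]; last exact: L_ge0.
exists (a *: p + q) => //; rewrite /comb/= L_linear; congr pair.
by apply/funext => x; rewrite hornerD hornerZ.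
Qed.

Let maximal_graph : exists2 G, positive_graph G &
  forall G', positive_graph G' -> G `<=` G' -> G' `<=` G.
Proof.
(* Zorn's lemma is applied to sets whose union with [poly_graph] is positive, so that the empty
   chain is covered too. *)
have [|A [PA Amax]] := @Zorn_bigcup _ [set G | positive_graph (G `|` poly_graph)].
  move=> F FP Ftot /=.
  have mem u v : ((\bigcup_(X in F) X) `|` poly_graph) u ->
      ((\bigcup_(X in F) X) `|` poly_graph) v ->
      exists2 G, positive_graph G & [/\ G u, G v & G `<=` (\bigcup_(X in F) X) `|` poly_graph].
    have sub X : F X -> X `|` poly_graph `<=` (\bigcup_(X in F) X) `|` poly_graph.
      by move=> FX w [Xw|?]; [left; exists X|right].
    move=> [[X FX Xu]|Lu] [[Y FY Yv]|Lv].
    - have [XY|YX] := Ftot X Y FX FY.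
        exists (Y `|` poly_graph); first exact: FP.
        by split; [left; exact: XY|left|exact: sub].
      exists (X `|` poly_graph); first exact: FP.
      by split; [left|left; exact: YX|exact: sub].
    - by exists (X `|` poly_graph); [exact: FP|split; [left|right|exact: sub]].
    - by exists (Y `|` poly_graph); [exact: FP|split; [right|left|exact: sub]].
    - by exists poly_graph => //; split => // w; right.
  split=> [|a u v /mem Uu /Uu[G [_ Gcomb _] [Gu Gv GU]]|u Uu].
  - exact: subsetUr.
  - exact/GU/Gcomb.
  - by have [G [_ _ Gpos] [Gu _ _]] := mem _ _ Uu Uu; exact: Gpos.
exists (A `|` poly_graph) => // G' PG' AG' u G'u.
apply: contrapT => nAu; apply: (Amax G'); last first.
  have [LG' _ _] := PG'.
  by rewrite /= setUidl.
rewrite properEneq; split; last by apply: subset_trans AG'; exact: subsetUl.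
by apply/eqP => AE; apply: nAu; left; rewrite AE.
Qed.

(* One-step extension: f gets the supremum of the values of its minorants. *)
Let graph_total G : positive_graph G ->
  (forall G', positive_graph G' -> G `<=` G' -> G' `<=` G) ->
  forall f, poly_dominated f -> exists c, G (f, c).
Proof.
move=> [LG Gcomb Gpos] Gmax f [q fq].
have Gp p : G (horner p, L p) by apply: LG; exists p.
have G0 : G (cst 0, 0).
  have -> : (cst 0, 0) = (horner 0, L 0) :> (R -> R) * R; last exact: Gp.
  congr pair; first by apply/funext => x; rewrite horner0.
  by have := L_linear (-1) 0 0; rewrite scaler0 addr0 mulN1r addNr.
pose S := [set a | exists2 g, G (g, a) & forall x, g x <= f x].
have Sub h b : G (h, b) -> (forall x, f x <= h x) -> ubound S b.
  move=> Gh fh a [g Gg gf]; rewrite -subr_ge0.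
  have := Gcomb (-1) _ _ Gg Gh; rewrite /comb/= => /Gpos/=.
  rewrite mulN1r addrC; apply => x.
  by rewrite mulN1r addrC subr_ge0 (le_trans (gf x)).
(* Domination by [q] gives the minorant [- q] and the majorant [q], so the set of values is nonempty
   and bounded above. *)
have Sq : S (- L q).
  exists (fun x => - q.[x]) => [|x]; last first.
    by have := fq x; rewrite ler_norml => /andP[].
  have := Gcomb (-1) _ _ (Gp q) G0; rewrite /comb/= mulN1r addr0.
  by under [X in G (X, _)]eq_fun do rewrite mulN1r addr0.
have hsS : has_sup S.
  split; first by exists (- L q).
  exists (L q); apply: Sub (Gp q) _ => x.
  by have := fq x; rewrite ler_norml => /andP[].
pose c := sup S.
have cmin h b : G (h, b) -> (forall x, f x <= h x) -> c <= b.
  by move=> Gh fh; apply: ge_sup; [exists (- L q)|exact: Sub Gh fh].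
have cmaj g a : G (g, a) -> (forall x, g x <= f x) -> a <= c.
  by move=> Gg gf; apply: ub_le_sup => //; [case: hsS|exists g].
pose G' := [set w | exists u t, G u /\ w = comb t (f, c) u].
have GG' : G `<=` G'.
  move=> [g a] Gg; exists (g, a), 0; split=> //; rewrite /comb/= mul0r add0r.
  by congr pair; apply/funext => x; rewrite mul0r add0r.
have scale a u : G u -> G (fun x => a * u.1 x, a * u.2).
  move=> Gu; have := Gcomb a _ _ Gu G0; rewrite /comb/= addr0.
  by under [X in G (X, _)]eq_fun do rewrite addr0.
exists c; apply: (Gmax G') => //; last first.
  exists (cst 0, 0), 1; split=> //; rewrite /comb/= mul1r addr0.
  by congr pair; apply/funext => x; rewrite mul1r addr0.
split=> [|a _ _ [u [t [Gu ->]]] [v [r [Gv ->]]]|_ [u [t [Gu ->]]]].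
- exact: subset_trans GG'.
- exists (comb a u v), (a * t + r); split; first exact: Gcomb.
  by rewrite /comb/=; congr pair; [apply/funext => x|]; ring.
rewrite /comb/= => h0.
(* Dividing t f + u >= 0 by |t| makes a multiple of [u] a majorant of [f] when t < 0 and a minorant
   when t > 0; [cmin] and [cmaj] then give the sign. For t = 0 positivity of [G] applies. *)
have [t0|t0|t0] := ltgtP t 0.
- have tn0 : t != 0 by rewrite lt_eqF.
  have /cmin cu := scale (- t)^-1 u Gu.
  have -> : t * c + u.2 = - t * ((- t)^-1 * u.2 - c) by field.
  apply: mulr_ge0; first by rewrite oppr_ge0 ltW.
  rewrite subr_ge0 cu// => x.
  have -> : (- t)^-1 * u.1 x = (- t)^-1 * (t * f x + u.1 x) + f x.
    by field.
  by rewrite lerDr mulr_ge0// invr_ge0 oppr_ge0 ltW.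
- have tn0 : t != 0 by rewrite gt_eqF.
  have /cmaj cu := scale (- t^-1) u Gu.
  have -> : t * c + u.2 = t * (c - (- t^-1 * u.2)) by field.
  apply: mulr_ge0; first exact: ltW.
  rewrite subr_ge0 cu// => x.
  have -> : - t^-1 * u.1 x = f x - t^-1 * (t * f x + u.1 x) by field.
  by rewrite gerBl mulr_ge0// invr_ge0 ltW.
- rewrite t0 mul0r add0r; apply: Gpos => // x.
  by have := h0 x; rewrite t0 mul0r add0r.
Qed.

Lemma riesz_extension : exists lam : (R -> R) -> R,
  [/\ forall p, lam (horner p) = L p,
      forall a f g, poly_dominated f -> poly_dominated g ->
        lam (fun x => a * f x + g x) = a * lam f + lam g
    & forall f, poly_dominated f -> (forall x, 0 <= f x) -> 0 <= lam f].
Proof.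
have [G PG Gmax] := maximal_graph; have Gtot := graph_total PG Gmax.
have [LG Gcomb Gpos] := PG.
have Gfun f c c' : G (f, c) -> G (f, c') -> c = c'.
  have le b b' : G (f, b) -> G (f, b') -> b <= b'.
    move=> Gb Gb'; have := Gcomb (-1) _ _ Gb Gb'; rewrite /comb/= => /Gpos/=.
    rewrite mulN1r addrC subr_ge0; apply => x.
    by rewrite mulN1r addNr.
  by move=> Gc Gc'; apply/eqP; rewrite eq_le !le.
(* A function outside the domain of the graph gets the default value 0; linearity and positivity are
   therefore claimed for dominated functions only. *)
pose lam f := xget 0 [set c | G (f, c)].
have lamP f : poly_dominated f -> G (f, lam f).
  by move=> /Gtot[c Gc]; exact: (@xgetI _ 0 [set c | G (f, c)] c Gc).
have lamE f c : G (f, c) -> lam f = c.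
  by move=> Gc; apply: (Gfun f _ _ _ Gc); exact: (@xgetI _ 0 [set c | G (f, c)] c Gc).
exists lam; split=> [p|a f g /lamP Gf /lamP Gg|f /lamP Gf f0].
- by apply/lamE/LG; exists p.
- exact/lamE/(Gcomb a _ _ Gf Gg).
- exact: Gpos Gf f0.
Qed.

End RieszExtension.

(** * Right-continuous versions of monotone functions *)

Section RightRegularization.
Variable R : realType.

Lemma right_regularization (F : R -> R) : nondecreasing F ->
  exists f : cumulative R R,
    (forall x, F x <= f x) /\ (forall x y, x < y -> f x <= F y).
Proof.
(* For monotone [F] this infimum is the right limit F(x+). *)
move=> ndF; pose g x := inf [set F y | y in [set y | x < y]].
have hs x : has_inf [set F y | y in [set y | x < y]].
  split; first by exists (F (x + 1)); exists (x + 1) => //=; rewrite ltrDl.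
  by exists (F x) => _ [y /= xy <-]; exact/ndF/ltW.
have gF x y : x < y -> g x <= F y.
  by move=> xy; apply: ge_inf; [exact: (hs x).2|exists y].
have Fg x : F x <= g x.
  apply: lb_le_inf; first exact: (hs x).1.
  by move=> _ [y /= xy <-]; exact/ndF/ltW.
have ndg : nondecreasing g.
  move=> x y; rewrite le_eqVlt => /predU1P[->//|xy].
  exact: le_trans (gF _ _ xy) (Fg y).
have rcg : right_continuous g.
  move=> x; apply/cvgrPdist_le => e e0.
  have [_ [y /= xy <-] Fy] := inf_adherent e0 (hs x).
  near=> z.
  have xz : x < z by near: z; exact: nbhs_right_gt.
  have zy : z < y by near: z; exact: nbhs_right_lt.
  rewrite ler0_norm ?subr_le0; last exact/ndg/ltW.
  rewrite opprB lerBlDl.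
  exact: le_trans (gF _ _ zy) (ltW Fy).
pose f : cumulative R R := HB.pack g (isCumulative.Build _ _ _ g ndg rcg).
by exists f.
Unshelve. all: end_near. Qed.

(* The intervals ]F x, f x[ are pairwise disjoint, so a rational picked in each
   of them makes the set of jumps countable. *)
Lemma regularization_eq_dense (F f : R -> R) :
  (forall x, F x <= f x) -> (forall x y, x < y -> f x <= F y) ->
  forall a b, a < b -> exists x, a < x < b /\ f x = F x.
Proof.
move=> Ff fF a b ab; apply: contrapT => nex.
have jump x : `]a, b[%classic x -> F x < f x.
  rewrite /= in_itv/= => xab; rewrite lt_neqAle Ff andbT.
  by apply/eqP => E; apply: nex; exists x.
have [q qP] : exists q : R -> rat, forall x, `]a, b[%classic x -> F x < ratr (q x) < f x.
  have /choice[q qP] : forall x, exists q : rat, `]a, b[%classic x -> F x < ratr q < f x.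
    move=> x; have [/jump/rat_in_itvoo[q]|nx] := pselect (`]a, b[%classic x); last by exists 0.
    by rewrite in_itv/= => qF; exists q.
  by exists q.
have : countable `]a, b[%classic.
  apply/countable_injP; exists (fun x => choice.pickle (q x)) => x y /set_mem xab /set_mem yab.
  move=> /(pcan_inj choice.pickleK) qxy; apply: contrapT => /eqP.
  have := qP _ xab; have := qP _ yab; rewrite qxy => /andP[y1 y2] /andP[x1 x2].
  rewrite neq_lt => /orP[/fF|/fF].
    by rewrite leNgt (lt_trans y1 x2).
  by rewrite leNgt (lt_trans x1 y2).
(* A countable set is Lebesgue null, whereas the interval has measure b - a > 0. *)
move=> /countable_lebesgue_measure0; rewrite lebesgue_measure_itv/= lte_fin ab.
by move=> /eqP; rewrite -EFinB eqe subr_eq0 gt_eqF.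
Qed.

End RightRegularization.

(** * Approximation of monomials by step functions *)

Section StepApproximation.
Variable R : realType.

Definition below (b x : R) : R := (x <= b)%R%:R.

(** The value is [c j] on ]t_j, t_(j+1)]. The form as differences of half-line indicators lets a
    linear functional be evaluated from its values on [below]. *)
Definition step_fun n (c t : nat -> R) x :=
  \sum_(j < n) c j * (below (t j.+1) x - below (t j) x).

Lemma step_funP n (c t : nat -> R) x : (forall j, t j <= t j.+1) ->
  (step_fun n c t x = 0 /\ (x <= t 0%N \/ t n < x)) \/
  exists j, [/\ (j < n)%N, t j < x <= t j.+1 & step_fun n c t x = c j].
Proof.
move=> ndt; have t_mono := homo_leq (@lexx _ _) (@le_trans _ _) ndt.
elim: n => [|n IHn].
  left; rewrite /step_fun big_ord0; split=> //.
  by case: (leP x (t 0%N)); [left|right].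
have E : step_fun n.+1 c t x = step_fun n c t x + c n * (below (t n.+1) x - below (t n) x).
  by rewrite /step_fun big_ord_recr.
have [xn|nx] := leP x (t n).
  have -> : step_fun n.+1 c t x = step_fun n c t x.
    by rewrite E /below xn (le_trans xn (ndt n)) subrr mulr0 addr0.
  case: IHn => [[-> [|]]|[j [jn xj ->]]]; first by left; split => //; left.
    by rewrite ltNge xn.
  by right; exists j; split => //; exact: ltnW.
have s0 : step_fun n c t x = 0.
  case: IHn => [[]//|[j [jn /andP[_ xj] _]]].
  by have := lt_le_trans nx xj; rewrite ltNge t_mono.
have [xn1|n1x] := leP x (t n.+1).
  right; exists n; split => //; first by rewrite nx.
  by rewrite E s0 /below xn1 leNgt nx/= subr0 mulr1 add0r.
left; split; last by right.
by rewrite E s0 /below leNgt n1x leNgt nx/= subrr mulr0 addr0.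
Qed.

Lemma exprB_bound k (B x y : R) : 1 <= B -> `|x| <= B -> `|y| <= B ->
  `|x ^+ k - y ^+ k| <= k%:R * B ^+ k * `|x - y|.
Proof.
move=> B1 xB yB; have B0 : 0 <= B by exact: le_trans B1.
elim: k => [|k IHk]; first by rewrite !expr0 subrr normr0 !mul0r.
have -> : x ^+ k.+1 - y ^+ k.+1 = x * (x ^+ k - y ^+ k) + (x - y) * y ^+ k.
  by rewrite !exprS; ring.
apply: le_trans (ler_normD _ _) _; rewrite !normrM normrX.
have h1 : `|x| * `|x ^+ k - y ^+ k| <= B * (k%:R * B ^+ k * `|x - y|).
  exact: ler_pM.
have h2 : `|x - y| * `|y| ^+ k <= `|x - y| * B ^+ k.+1.
  rewrite ler_wpM2l//; apply: le_trans (_ : B ^+ k <= _).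
    by rewrite lerXn2r.
  by rewrite exprS ler_peMl// exprn_ge0.
apply: le_trans (lerD h1 h2) _.
by rewrite le_eqVlt; apply/orP; left; apply/eqP; rewrite -natr1 exprS; ring.
Qed.

(** Inside a large interval a fine grid gives a uniform error [e]; outside it the step function is 0
    and x^k is absorbed by e x^(2k+2). [D] will be the dense set where a distribution function
    agrees with its regularization, and nonnegative values for even [k] serve Fatou's lemma. *)
Lemma step_approx (D : set R) (k : nat) (e : R) :
  (forall a b, a < b -> exists x, a < x < b /\ D x) -> 0 < e ->
  exists n c t, [/\ forall j, t j <= t j.+1, forall j, D (t j),
    forall x, `|x ^+ k - step_fun n c t x| <= e * (1 + x ^+ (2 * k.+1))
    & ~~ odd k -> forall j, 0 <= c j].
Proof.
move=> Ddense e0.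
(* For |x| >= N both |x| >= 1 and e |x| >= 1 hold, so |x|^k <= e |x|^(2k+2). The margin B - N = 1
   allows for the first breakpoint lying up to [h] to the right of -B. *)
pose N : R := 1 + e^-1; pose B := N + 1.
have ei0 : 0 < e^-1 by rewrite invr_gt0.
have N1 : 1 <= N by rewrite lerDl ltW.
have N0 : 0 < N by exact: lt_le_trans N1.
have B1 : 1 <= B by rewrite /B; lra.
have B0 : 0 < B by exact: lt_le_trans B1.
pose K := k%:R * (B + 2) ^+ k.
have K0 : 0 <= K by rewrite mulr_ge0// exprn_ge0// addr_ge0// ltW.
(* [K] is a Lipschitz constant of x^k on [-B - 2, B + 2], and a cell will have length at most 2h. *)
have [h [h0 h1 Kh]] : exists h, [/\ 0 < h, h <= 1 & K * (2 * h) <= e].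
  have K1 : 0 < 2 * (K + 1) by rewrite mulr_gt0 ?ltr_wpDl.
  exists (Num.min 1 (e / (2 * (K + 1)))); split.
  - by rewrite lt_min ltr01 divr_gt0.
  - by rewrite ge_min lexx.
  have : Num.min 1 (e / (2 * (K + 1))) <= e / (2 * (K + 1)) by rewrite ge_min lexx orbT.
  have : 0 < Num.min 1 (e / (2 * (K + 1))) by rewrite lt_min ltr01 divr_gt0.
  move: (Num.min _ _) => h h0; rewrite ler_pdivlMr// => hK; apply: le_trans hK.
  by nra.
(* One point of [D] is taken in each interval of a grid of mesh [h], so consecutive breakpoints are
   less than 2h apart. *)
have /choice[t tP] : forall j, exists x, - B + j%:R * h < x < - B + j.+1%:R * h /\ D x.
  by move=> j; apply: Ddense; rewrite ltrD2l ltr_pM2r// ltr_nat.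
pose n := (Num.truncn (2 * B / h)).+1.
have nh : 2 * B <= n%:R * h.
  by rewrite -ler_pdivrMr// ltW// truncnS_gt.
have nd j : t j <= t j.+1.
  have [/andP[_ /ltW tj] _] := tP j; have [/andP[/ltW tj1 _] _] := tP j.+1.
  exact: le_trans tj tj1.
exists n, (fun j => t j ^+ k), t; split=> //.
- by move=> j; have [] := tP j.
- move=> x; have x2 : 0 <= x ^+ (2 * k.+1) by rewrite exprM exprn_ge0// sqr_ge0.
  case: (@step_funP n (fun j => t j ^+ k) t x nd) => [[-> xout]|[j [jn /andP[tj tj1] ->]]].
    have xN : N <= `|x|.
      case: xout => [x0|xn].
        have [/andP[_ t0] _] := tP 0%N; rewrite mul1r in t0.
        rewrite ler_normr; apply/orP; right; rewrite /B in t0; lra.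
      have [/andP[tn _] _] := tP n.
      rewrite ler_normr; apply/orP; left; rewrite /B in tn nh; lra.
    rewrite subr0 normrX; apply: le_trans (_ : e * `|x| ^+ (2 * k.+1) <= _).
      have x1 : 1 <= `|x| by exact: le_trans xN.
      have ex : 1 <= e * `|x|.
        rewrite mulrC -ler_pdivrMr// mul1r; apply: le_trans xN.
        by rewrite lerDr.
      have E2 : (2 * k.+1 = k + k.+2)%N by rewrite mul2n -addnn addSnnS.
      rewrite {}E2 exprD mulrCA ler_peMr ?exprn_ge0// exprS mulrA.
      by rewrite -[leLHS]mul1r ler_pM// exprn_ege1.
    rewrite ler_pM2l// -normrX ger0_norm// lerDr//.
  apply: le_trans (_ : e <= _); last by rewrite ler_peMr ?(ltW e0)// lerDl.
  have nh2 : n%:R * h <= 2 * B + h.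
    rewrite /n -[in leLHS]natr1 mulrDl mul1r lerD2r -ler_pdivlMr//.
    by rewrite truncn_le// divr_ge0 ?mulr_ge0 ?(ltW h0) ?(ltW B0).
  have [/andP[ltj tlj] _] := tP j; have [/andP[_ tlj1] _] := tP j.+1.
  have jn2 : j.+2%:R * h <= n%:R * h + h.
    by rewrite -[X in _ + X]mul1r -mulrDl ler_wpM2r ?(ltW h0)// natr1 ler_nat.
  have j0 : 0 <= j%:R * h by rewrite mulr_ge0// ltW.
  have jh : j.+2%:R * h = j%:R * h + 2 * h by rewrite -addn2 natrD mulrDl.
  have xB : `|x| <= B + 2 by rewrite ler_norml; apply/andP; split; lra.
  have tB : `|t j| <= B + 2 by rewrite ler_norml; apply/andP; split; lra.
  have xt : `|x - t j| <= 2 * h by rewrite ler_norml; apply/andP; split; lra.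
  have B2 : 1 <= B + 2 by lra.
  apply: le_trans (exprB_bound k B2 xB tB) _.
  by apply: le_trans Kh; rewrite ler_wpM2l.
- move=> ek j; rewrite -[k]odd_double_half (negbTE ek) add0n -mul2n exprM.
  by rewrite exprn_ge0// sqr_ge0.
Qed.

End StepApproximation.

(** * Linearity and comparison for real-valued integrals *)

Section RealIntegral.
Variables (R : realType) (mu : {measure set (measurableTypeR R) -> \bar R}).
Implicit Types f g h : measurableTypeR R -> R.
Local Notation integrable f := (mu.-integrable [set: measurableTypeR R] (EFin \o f)).
Local Notation "'\I' f" := (Rintegral mu [set: measurableTypeR R] f) (at level 10).

Lemma integrable_lin a f g : integrable f -> integrable g ->
  integrable (fun x => a * f x + g x).
Proof.
move=> If Ig; have := integrableD measurableT (integrableZl measurableT a If) Ig.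
by apply: eq_integrable => // x _; rewrite /= EFinD EFinM.
Qed.

Lemma Rintegral_lin a f g : integrable f -> integrable g ->
  \I (fun x => a * f x + g x) = a * \I f + \I g.
Proof.
move=> If Ig; rewrite RintegralD//; first by rewrite RintegralZl.
by have := integrableZl measurableT a If; apply: eq_integrable => // x _; rewrite /= EFinM.
Qed.

Lemma integrable_cst0 : integrable (fun=> 0).
Proof. exact: integrable0. Qed.

Lemma integrable_sumr n (f : nat -> measurableTypeR R -> R) (c : nat -> R) :
  (forall j, integrable (f j)) -> integrable (fun x => \sum_(j < n) c j * f j x).
Proof.
move=> If; elim: n => [|n IHn].
  have -> : (fun x => \sum_(j < 0) c j * f j x) = (fun=> 0).
    by apply/funext => x; rewrite big_ord0.
  exact: integrable_cst0.
have -> : (fun x => \sum_(j < n.+1) c j * f j x) =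
    (fun x => c n * f n x + \sum_(j < n) c j * f j x).
  by apply/funext => x; rewrite big_ord_recr addrC.
exact: integrable_lin.
Qed.

Lemma Rintegral_sumr n (f : nat -> measurableTypeR R -> R) (c : nat -> R) :
  (forall j, integrable (f j)) ->
  \I (fun x => \sum_(j < n) c j * f j x) = \sum_(j < n) c j * \I (f j).
Proof.
move=> If; elim: n => [|n IHn].
  under eq_Rintegral do rewrite big_ord0.
  by rewrite big_ord0 Rintegral_cst// mul0r.
have -> : (fun x => \sum_(j < n.+1) c j * f j x) =
    (fun x => c n * f n x + \sum_(j < n) c j * f j x).
  by apply/funext => x; rewrite big_ord_recr addrC.
rewrite Rintegral_lin//; last exact: integrable_sumr.
by rewrite IHn [in RHS]big_ord_recr/= addrC.
Qed.

Lemma integrable_le f g : measurable_fun [set: measurableTypeR R] f ->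
  (forall x, `|f x| <= g x) -> integrable g -> integrable f.
Proof.
move=> mf fg; apply: le_integrable => //; first exact/measurable_EFinP.
by move=> x _; rewrite /= lee_fin (le_trans (fg x))// ler_norm.
Qed.

Lemma Rintegral_dist_le f g h : integrable f -> integrable g -> integrable h ->
  (forall x, `|f x - g x| <= h x) -> `|\I f - \I g| <= \I h.
Proof.
move=> If Ig Ih fgh; rewrite -RintegralB//.
have Ifg : integrable (fun x => f x - g x).
  have := integrable_lin (-1) Ig If.
  by apply: eq_integrable => // x _; rewrite /= mulN1r addrC.
apply: le_trans (le_normr_Rintegral measurableT Ifg) _.
by apply: le_Rintegral => //; exact: integrable_norm.
Qed.

End RealIntegral.

(** * Polynomials integrated against a solution *)

Section Solutions.
Variables (R : realType) (s : nat -> R).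
Local Notation L := (moment_functional s).

Lemma hamburger_solution_poly (rho : {measure set (measurableTypeR R) -> \bar R}) :
  hamburger_solution s rho -> forall p : {poly R},
    rho.-integrable [set: measurableTypeR R] (EFin \o horner p) /\
    Rintegral rho [set: measurableTypeR R] (horner p) = L p.
Proof.
move=> rhoP p; have IX k : rho.-integrable [set: measurableTypeR R] (EFin \o (fun x => x ^+ k)).
  exact: (rhoP k).1.
have -> : horner p = (fun x => \sum_(k < size p) p`_k * x ^+ k).
  by apply/funext => x; rewrite horner_coef.
split; first exact: (@integrable_sumr _ rho _ (fun k x => x ^+ k) (fun k => p`_k)).
rewrite (@Rintegral_sumr _ rho _ (fun k x => x ^+ k) (fun k => p`_k))//.
by apply: eq_bigr => k _; rewrite /Rintegral (rhoP k).2.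
Qed.

Lemma hamburger_solution_Xn (rho : {measure set (measurableTypeR R) -> \bar R}) :
  (forall k, rho.-integrable [set: measurableTypeR R] (EFin \o (fun x => x ^+ k)) /\
    Rintegral rho [set: measurableTypeR R] (fun x => x ^+ k) = s k) ->
  hamburger_solution s rho.
Proof.
move=> rhoP k; have [I E] := rhoP k; split; first exact: I.
by rewrite -E /Rintegral fineK//; exact: integrable_fin_num I.
Qed.

Lemma hamburger_solution_mass (rho : {measure set (measurableTypeR R) -> \bar R}) :
  hamburger_solution s rho -> rho [set: measurableTypeR R] = (s 0%N)%:E.
Proof.
by move=> /(_ 0%N)[_ <-]; rewrite -[LHS]mul1e -integral_cst.
Qed.

End Solutions.

(** * The Stieltjes measure of the extended functional *)

Section Existence.
Variables (R : realType) (s : nat -> R).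
Local Notation L := (moment_functional s).
Hypothesis L_sqr_ge0 : forall p : {poly R}, 0 <= L (p * p).

Lemma poly_dominated_horner (p : {poly R}) : poly_dominated (horner p).
Proof.
exists (1 + p * p) => x; rewrite hornerD hornerM hornerC ler_norml.
have := sqr_ge0 (p.[x] - 1); have := sqr_ge0 (p.[x] + 1).
by move=> h1 h2; apply/andP; split; nra.
Qed.

Lemma poly_dominated_lin a (f g : R -> R) : poly_dominated f -> poly_dominated g ->
  poly_dominated (fun x => a * f x + g x).
Proof.
move=> [p fp] [q gq]; exists (`|a| *: p + q) => x.
rewrite hornerD hornerZ; apply: le_trans (ler_normD _ _) _.
by rewrite normrM lerD// ler_wpM2l.
Qed.

Lemma poly_dominated_below (b : R) : poly_dominated (below b).
Proof. by exists 1 => x; rewrite hornerC /below; case: (x <= b)%R; rewrite ?normr1 ?normr0. Qed.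

Lemma poly_dominated_step n (c t : nat -> R) : poly_dominated (step_fun n c t).
Proof.
elim: n => [|n [q IHn]].
  by exists 0 => x; rewrite /step_fun big_ord0 normr0 horner0.
have [p pP] : poly_dominated (fun x : R => -1 * below (t n) x + below (t n.+1) x).
  by apply: poly_dominated_lin; exact: poly_dominated_below.
exists (`|c n| *: p + q) => x.
rewrite /step_fun big_ord_recr/= addrC hornerD hornerZ.
apply: le_trans (ler_normD _ _) _; rewrite lerD//; last exact: IHn.
by rewrite normrM ler_wpM2l// addrC -mulN1r.
Qed.

(** The extension [lam] of L, evaluated on half-line indicators, is a monotone function [F]; the
    measure is the Stieltjes measure of its right-continuous version [f]. Integral and [lam] agree
    on step functions with breakpoints where f = F, and these approximate x^k up to a small multiple
    of a polynomial, whose value under [lam] is known. *)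
Lemma hamburger_existence :
  exists rho : {measure set (measurableTypeR R) -> \bar R}, hamburger_solution s rho.
Proof.
have [lam [lamL lam_lin lam_ge0]] := @riesz_extension _ L
  (moment_functional_linear s) (fun p => psd_functional_ge0 L_sqr_ge0).
have lamZ a f : poly_dominated f -> lam (fun x : R => a * f x) = a * lam f.
  move=> df; have d0 : poly_dominated (horner (0 : {poly R})) by exact: poly_dominated_horner.
  have := lam_lin a f _ df d0; rewrite lamL moment_functional0 addr0 => <-.
  by congr lam; apply/funext => x; rewrite horner0 addr0.
have lamB f g : poly_dominated f -> poly_dominated g ->
    lam (fun x : R => f x - g x) = lam f - lam g.
  move=> df dg; rewrite addrC -mulN1r -(lam_lin (-1) _ _ dg df).
  by congr lam; apply/funext => x; rewrite mulN1r addrC.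
have dom_ext (f g : R -> R) : f =1 g -> poly_dominated f -> poly_dominated g.
  by move=> /funext ->.
have domB f g : poly_dominated f -> poly_dominated g -> poly_dominated (fun x : R => f x - g x).
  move=> df dg; apply: (dom_ext (fun x => -1 * g x + f x)).
    by move=> x; rewrite mulN1r addrC.
  exact: poly_dominated_lin.
have lam_le f g : poly_dominated f -> poly_dominated g -> (forall x, f x <= g x) ->
    lam f <= lam g.
  move=> df dg fg; rewrite -subr_ge0 -lamB//; apply: lam_ge0; first exact: domB.
  by move=> x; rewrite subr_ge0.
pose F b := lam (below b).
have ndF : nondecreasing F.
  move=> a b ab; apply: lam_le; try exact: poly_dominated_below.
  move=> x; rewrite /below; case: (leP x a) => //= xa.
  by rewrite (le_trans xa ab).
have lam_step n c t : lam (step_fun n c t) = \sum_(j < n) c j * (F (t j.+1) - F (t j)).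
  elim: n => [|n IHn].
    rewrite big_ord0; have := lamZ 0 _ (poly_dominated_below 0); rewrite mul0r => <-.
    by congr lam; apply/funext => x; rewrite /step_fun big_ord0 mul0r.
  rewrite big_ord_recr/= -IHn addrC /F -lamB; try exact: poly_dominated_below.
  rewrite -lam_lin; last exact: poly_dominated_step.
    by congr lam; apply/funext => x; rewrite /step_fun big_ord_recr/= addrC.
  by apply: domB; exact: poly_dominated_below.
have [f [Ff fF]] := right_regularization ndF.
pose mu : {measure set (measurableTypeR R) -> \bar R} := lebesgue_stieltjes_measure f.
have muE a b : a <= b -> mu `]a, b]%classic = (f b - f a)%:E.
  move=> ab; rewrite /mu/= /lebesgue_stieltjes_measure /measure_extension.
  by rewrite measurable_mu_extE/= ?wlength_itv_bnd//; exact: is_ocitv.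
have belowE a b : a <= b -> (fun x => below b x - below a x) = \1_(`]a, b]%classic).
  move=> ab; apply/funext => x; rewrite indicE /below.
  have -> : (x \in `]a, b]%classic) = (a < x <= b).
    by apply/idP/idP => [/set_mem|h]; [|apply/mem_set]; rewrite /= in_itv.
  case: (leP x a) => xa /=; last by rewrite subr0.
  by rewrite (le_trans xa ab) subrr.
have int_below a b : a <= b -> mu.-integrable [set: measurableTypeR R]
    (EFin \o (fun x => below b x - below a x)) /\
    Rintegral mu [set: measurableTypeR R] (fun x => below b x - below a x) = f b - f a.
  move=> ab; rewrite belowE//; have mab : measurable (`]a, b]%classic : set (measurableTypeR R)).
    exact: measurable_itv.
  have E : (\int[mu]_x (\1_(`]a, b]%classic) x)%:E = (f b - f a)%:E)%E.
    by rewrite integral_indic// setIT muE.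
  split; last by rewrite /Rintegral E.
  apply/integrableP; split; first exact/measurable_EFinP/measurable_indic.
  rewrite (_ : (\int[mu]_x _)%E = (\int[mu]_x (\1_(`]a, b]%classic) x)%:E)%E).
    by rewrite E ltry.
  by apply: eq_integral => x _; rewrite /= ger0_norm.
have int_step n (c t : nat -> R) : (forall j, t j <= t j.+1) -> (forall j, f (t j) = F (t j)) ->
    mu.-integrable [set: measurableTypeR R] (EFin \o step_fun n c t) /\
    Rintegral mu [set: measurableTypeR R] (step_fun n c t) = lam (step_fun n c t).
  move=> ndt tD; pose g j (x : measurableTypeR R) := below (t j.+1) x - below (t j) x.
  have Ig j : mu.-integrable [set: measurableTypeR R] (EFin \o g j).
    exact: (int_below _ _ (ndt j)).1.
  split; first exact: (@integrable_sumr _ mu n g c Ig).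
  rewrite [LHS](@Rintegral_sumr _ mu n g c Ig) lam_step; apply: eq_bigr => j _.
  by rewrite (int_below _ _ (ndt j)).2 !tD.
have Ddense := regularization_eq_dense Ff fF.
pose E k (x : R) := 1 + x ^+ (2 * k.+1).
have EL k : E k = horner (1 + 'X^(2 * k.+1)).
  by apply/funext => x; rewrite hornerD hornerC hornerXn.
have domE k : poly_dominated (E k) by rewrite EL; exact: poly_dominated_horner.
have XL k : (fun x : R => x ^+ k) = horner 'X^k.
  by apply/funext => x; rewrite hornerXn.
have domX k : poly_dominated (fun x : R => x ^+ k).
  by rewrite XL; exact: poly_dominated_horner.
have lamX k : lam (fun x : R => x ^+ k) = s k.
  by rewrite XL lamL moment_functionalXn.
have lam_approx k e n c t :
    (forall x, `|x ^+ k - step_fun n c t x| <= e * E k x) ->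
    `|s k - lam (step_fun n c t)| <= e * lam (E k).
  move=> h; rewrite -lamX -lamB//; last exact: poly_dominated_step.
  have dd := domB _ _ (domX k) (poly_dominated_step n c t).
  have domeE (r : R) : poly_dominated (fun x : R => r * E k x).
    by rewrite EL; have := poly_dominated_horner (r *: (1 + 'X^(2 * k.+1)));
      apply: dom_ext => x; rewrite hornerZ.
  rewrite ler_norml -mulNr -!lamZ//.
  by apply/andP; split; apply: lam_le => // x; have := h x; rewrite ler_norml -mulNr => /andP[].
have harm (u : nat -> R) a l : (forall i, `|a - u i| <= i.+1%:R^-1 * l) -> u i @[i --> \oo] --> a.
  move=> h; apply/cvgrPdist_le => e e0; near=> i; apply: le_trans (h i) _.
  have l1 : 0 < `|l| + 1 by rewrite ltr_wpDl.
  apply: (@le_trans _ _ (i.+1%:R^-1 * (`|l| + 1))).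
    by rewrite ler_wpM2l ?invr_ge0// (le_trans (ler_norm l))// lerDl.
  rewrite mulrC ler_pdivrMr// -ler_pdivrMl// mulrC.
  have : (`|l| + 1) / e <= i%:R by near: i; exact: nbhs_infty_ger.
  by move=> /le_trans; apply; rewrite ler_nat.
(* Nonnegative step functions converge pointwise to the even power, and their integrals converge to
   s_k, so Fatou's lemma bounds the integral. *)
have even_fin k : ~~ odd k -> (\int[mu]_x (x ^+ k)%:E < +oo)%E.
  move=> ek.
  have i0 (i : nat) : (0 : R) < i.+1%:R^-1 by rewrite invr_gt0.
  have /choice[n /choice[c /choice[t H]]] := fun i => step_approx k Ddense (i0 i).
  pose phi i := step_fun (n i) (c i) (t i).
  have [nd tD ap cpos] : [/\ forall i j, t i j <= t i j.+1,
      forall i j, f (t i j) = F (t i j),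
      forall i x, `|x ^+ k - phi i x| <= i.+1%:R^-1 * E k x & forall i j, 0 <= c i j].
    by split => i; have [? ? ? /(_ ek)?] := H i.
  have phi0 i x : 0 <= phi i x.
    case: (step_funP (n i) (c i) x (nd i)) => [[h _]|[j [_ _ h]]];
      by rewrite /phi h.
  have Iphi i := int_step (n i) (c i) (t i) (nd i) (tD i).
  have phicvg x : (phi i x)%:E @[i --> \oo] --> (x ^+ k)%:E.
    apply/cvg_EFin; first by near=> i.
    exact: harm (ap^~ x).
  have Fatou := @fatou _ _ _ mu setT measurableT (fun i x => (phi i x)%:E) _ _.
  have {}Fatou : (\int[mu]_x (x ^+ k)%:E <= limn_einf (fun i => \int[mu]_x (phi i x)%:E))%E.
    apply: le_trans (Fatou _ _).
    - rewrite le_eqVlt; apply/orP; left; apply/eqP; apply: eq_integral => x _.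
      by rewrite (cvg_limn_einf_sup (phicvg x)).1.
    - by move=> i; have /integrableP[] := (Iphi i).1.
    - by move=> i x _; rewrite lee_fin.
  apply: le_lt_trans Fatou _.
  have lamcvg : (\int[mu]_x (phi i x)%:E)%E @[i --> \oo] --> (s k)%:E.
    have -> : (fun i => (\int[mu]_x (phi i x)%:E)%E) = (fun i => (lam (phi i))%:E).
      apply/funext => i; have [I <-] := Iphi i.
      by rewrite /Rintegral fineK//; exact: integrable_fin_num I.
    apply/cvg_EFin; first by near=> i.
    by apply: (harm _ _ (lam (E k))) => i; apply: lam_approx (ap i).
  by rewrite (cvg_limn_einf_sup lamcvg).1 ltry.
have mX k : measurable_fun [set: measurableTypeR R] (fun x : R => x ^+ k).
  by rewrite XL; exact: measurable_poly.
have even_int k : ~~ odd k -> mu.-integrable [set: measurableTypeR R] (EFin \o (fun x => x ^+ k)).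
  move=> ek; apply/integrableP; split.
    by apply/measurable_EFinP; exact: mX.
  rewrite (_ : (\int[mu]_x _)%E = (\int[mu]_x (x ^+ k)%:E)%E); first exact: even_fin.
  apply: eq_integral => x _; rewrite /= ger0_norm//.
  by rewrite -[k]odd_double_half (negbTE ek) add0n -mul2n exprM exprn_ge0// sqr_ge0.
have intE k : mu.-integrable [set: measurableTypeR R] (EFin \o E k).
  have : mu.-integrable [set: measurableTypeR R] (EFin \o (fun x => 1 * x ^+ 0 + x ^+ (2 * k.+1))).
    by apply: integrable_lin; apply: even_int; rewrite ?oddM.
  by apply: eq_integrable => // x _; rewrite /= expr0 mulr1.
(* Odd powers follow by domination: |x|^k <= 1 + x^(2k+2), a sum of even powers. *)
have intX k : mu.-integrable [set: measurableTypeR R] (EFin \o (fun x => x ^+ k)).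
  apply: (integrable_le (mX k) _ (intE k)) => x.
  rewrite /E normrX mul2n -addnn exprD.
  have -> : x ^+ k.+1 * x ^+ k.+1 = `|x| ^+ k.+1 * `|x| ^+ k.+1.
    by rewrite -!expr2 -normrX real_normK ?num_real.
  have [x1|/ltW x1] := leP 1 `|x|.
    have x2 : `|x| ^+ k <= `|x| ^+ k.+1 by rewrite exprS ler_peMl// exprn_ge0.
    have x3 : 1 <= `|x| ^+ k.+1 by rewrite exprn_ege1.
    by nra.
  have x2 : `|x| ^+ k <= 1 by rewrite exprn_ile1.
  apply: le_trans x2 _; rewrite lerDl mulr_ge0// exprn_ge0//.
exists mu; apply: hamburger_solution_Xn => k; split; first exact: intX.
(* A step function of accuracy e / (C + 1) is compared with x^k twice, under the integral and under
   [lam]; the two errors add up to at most e C / (C + 1). *)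
pose C := Rintegral mu [set: measurableTypeR R] (E k) + lam (E k).
apply/eqP; rewrite -subr_eq0 -normr_le0; apply/ler_addgt0Pl => e e0; rewrite addr0.
have C0 : 0 <= C.
  have E0 x : 0 <= E k x by rewrite addr_ge0// exprM exprn_ge0// sqr_ge0.
  apply: addr_ge0; last exact: lam_ge0.
  by apply: Rintegral_ge0 => x _; exact: E0.
have d0 : 0 < e / (C + 1) by rewrite divr_gt0// ltr_wpDl.
have [n [c [t [nd tD ap _]]]] := step_approx k Ddense d0.
have [Is Es] := int_step n c t nd tD.
have IdE : mu.-integrable [set: measurableTypeR R] (EFin \o (fun x => e / (C + 1) * E k x + 0)).
  by apply: integrable_lin => //; exact: integrable_cst0.
have h1 : `|Rintegral mu [set: measurableTypeR R] (fun x => x ^+ k) - lam (step_fun n c t)| <=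
    e / (C + 1) * Rintegral mu [set: measurableTypeR R] (E k).
  rewrite -Es; apply: le_trans (Rintegral_dist_le (intX k) Is IdE _) _.
    by move=> x; rewrite addr0.
  rewrite Rintegral_lin//; last exact: integrable_cst0.
  by rewrite Rintegral_cst// mul0r addr0.
have h2 := lam_approx k _ n c t ap.
apply: le_trans (ler_distD (lam (step_fun n c t)) _ _) _.
rewrite [X in _ + X]distrC; apply: le_trans (lerD h1 h2) _.
rewrite -mulrDr -/C mulrAC ler_pdivrMr ?ltr_wpDl//.
by rewrite ler_wpM2l ?(ltW e0)// lerDl.
Unshelve. all: end_near. Qed.

End Existence.

(** * Solutions with prescribed atoms *)

Section Atoms.
Variable R : realType.
Implicit Types s : nat -> R.

Definition atom (c : {nonneg R}) (t : R) : {measure set (measurableTypeR R) -> \bar R} :=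
  mscale c (dirac (t : measurableTypeR R)).

Lemma integral_atom (c : {nonneg R}) (t : R) (f : measurableTypeR R -> R) :
  measurable_fun [set: measurableTypeR R] f ->
  (atom c t).-integrable
    [set: measurableTypeR R] (EFin \o f) /\
  (\int[(atom c t)]_x (f x)%:E =
    (c%:num * f t)%:E)%E.
Proof.
move=> mf; have ge0E (g : measurableTypeR R -> \bar R) : measurable_fun setT g ->
    (forall x, 0 <= g x)%E ->
    (\int[(atom c t)]_x g x =
      c%:num%:E * g t)%E.
  by move=> mg g0; rewrite ge0_integral_mscale// integral_dirac// diracT mul1e.
have mE : measurable_fun setT (EFin \o f) by exact/measurable_EFinP.
split.
  apply/integrableP; split => //.
  rewrite ge0E//=; last first.
    by apply/measurable_EFinP; exact: (measurableT_comp (@normr_measurable R setT)).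

  by rewrite -EFinM ltry.
rewrite integralE ge0E; [|exact: measurable_funepos|by move=> x; exact: funepos_ge0].
rewrite ge0E; [|exact: measurable_funeneg|by move=> x; exact: funeneg_ge0].
rewrite -muleBr//; last by exact: add_def_funeposneg.
have h := congr1 (fun g => g t) (funeposneg (EFin \o f)).
by rewrite /= in h; rewrite -h EFinM.
Qed.

(** Adding the mass [c] at [t] to [rho] restores the subtracted moments. *)
Lemma hamburger_solution_atom s (c : R) (t : R)
    (rho : {measure set (measurableTypeR R) -> \bar R}) :
  0 <= c -> hamburger_solution (fun k => s k - c * t ^+ k) rho ->
  exists rho' : {measure set (measurableTypeR R) -> \bar R},
    hamburger_solution s rho' /\ (c%:E <= rho' [set t])%E.
Proof.
move=> c0 rhoP; pose k : {nonneg R} := NngNum c0.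
pose d := atom k t.
exists (measure_add rho d); split=> [n|].
  have [In En] := rhoP n.
  have mX : measurable_fun [set: measurableTypeR R] (fun x : R => x ^+ n).
    by have /integrableP[/measurable_EFinP] := In.
  have [Id Ed] := integral_atom k t mX.
  split; last by rewrite integral_measure_add//= En Ed/= -EFinD subrK.
  apply/integrableP; split; first exact/measurable_EFinP.
  rewrite ge0_integral_measure_add//; last exact/measurableT_comp/measurable_EFinP.
  by apply: lte_add_pinfty; [have /integrableP[] := In|have /integrableP[] := Id].
have E : measure_add rho d [set t] = (rho [set t] + c%:E)%E.
  by rewrite measure_addE /d /atom /= /mscale/= diracE mem_set// mule1.
suff : (c%:E <= measure_add rho d [set t])%E by [].
by rewrite E leeDr.
Qed.

(** Otherwise the distinct points 1/(j+1) of [0,1] would all have mass at least [c], and more than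
    rho(R)/c of them exceed the total mass. *)
Lemma exists_small_atom (rho : {measure set (measurableTypeR R) -> \bar R}) (c : R) :
  0 < c -> (rho [set: measurableTypeR R] < +oo)%E ->
  exists2 t : R, 0 <= t <= 1 & (rho [set t] < c%:E)%E.
Proof.
move=> c0 rhoT; apply: contrapT => nex.
pose t (j : nat) : R := j.+1%:R^-1.
have tc j : (c%:E <= rho [set t j])%E.
  rewrite leNgt; apply/negP => h; apply: nex; exists (t j) => //.
  by rewrite invr_ge0 ler0n invf_le1// ler1n.
have [r rE] : exists r, rho [set: measurableTypeR R] = r%:E.
  exists (fine (rho [set: measurableTypeR R])); rewrite fineK//.
  by rewrite ge0_fin_numE// measure_ge0.
pose N := (Num.truncn (r / c)).+1.
have : (\sum_(j < N) rho [set t j] <= r%:E)%E.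
  rewrite -rE -(@measure_bigsetU _ _ _ rho (fun j => [set t j])) //.
  - by apply: le_measure; rewrite ?inE//; exact: bigsetU_measurable.
  - move=> i j _ _ [x [/= -> /eqP]].
    by rewrite (inj_eq invr_inj) eqr_nat eqSS => /eqP.
apply/negP; rewrite -ltNge.
apply: (@lt_le_trans _ _ (\sum_(j < N) c%:E)%E); last by apply: lee_sum => j _; exact: tc.
rewrite sumEFin lte_fin sumr_const card_ord -mulr_natl -ltr_pdivrMr//.
exact: truncnS_gt.
Qed.

Lemma square_summable_indeterminate s :
  (forall N : nat, posdefmx (hankelmx s N)) ->
  square_summable (fun n => (orthopoly s n).[0]) ->
  square_summable (fun n => (orthopoly s n)^`().[0]) ->
  hamburger_indeterminate s.
Proof.
move=> s_pos sP sP'; have [M M0 bound] := evaluation_bound s_pos sP sP'.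
have sol t : 0 <= t <= 1 -> exists rho : {measure set (measurableTypeR R) -> \bar R},
    hamburger_solution s rho /\ (M^-1%:E <= rho [set t])%E.
  move=> t01; have Mi0 : 0 <= M^-1 by rewrite invr_ge0 ltW.
  have [|rho rhoP] := @hamburger_existence _ (fun k => s k - M^-1 * t ^+ k).
    move=> p.
    have -> : moment_functional (fun k => s k - M^-1 * t ^+ k) (p * p) =
        moment_functional s (p * p) - M^-1 * p.[t] ^+ 2.
      rewrite expr2 -hornerM horner_coef /moment_functional mulr_sumr -sumrB.
      by apply: eq_bigr => i _; ring.
    by rewrite subr_ge0 mulrC ler_pdivrMr// mulrC bound.
  exact: hamburger_solution_atom rhoP.
(* Any solution serves as [rho1]; the second one is chosen with a large atom at a point where [rho1]
   has a small one. *)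
have [|rho1 [sol1 _]] := sol 0; first by rewrite lexx ler01.
have [||t t01 rho1t] := @exists_small_atom rho1 M^-1; first by rewrite invr_gt0.
  by rewrite (hamburger_solution_mass sol1) ltry.
have [rho2 [sol2 rho2t]] := sol t t01.
exists rho1, rho2; split => //; exists [set t] => // E.
by move: rho1t; rewrite E ltNge rho2t.
Qed.

End Atoms.

(** * Resolvents *)

Section ResolventFunctionals.
Variables (R : realType) (s : nat -> R).
Hypothesis s_pos : forall N : nat, posdefmx (hankelmx s N).
Local Notation L := (moment_functional s).
Local Notation P := (orthopoly s).
Implicit Types p q : {poly R}.

(** With v the sum of the I(q P_n) P_n for n < N, both L(v^2) and I(q v) equal the partial sum S.
    Since I is dominated by K L, expanding I((q - v/K)^2) >= 0 gives S <= K I(q^2). *)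
Lemma bessel (I : {poly R} -> R) (K : R) (q : {poly R}) : 0 < K ->
  (forall a p q, I (a *: p + q) = a * I p + I q) ->
  (forall p, 0 <= I (p * p)) -> (forall p, I (p * p) <= K * L (p * p)) ->
  square_summable (fun n => I (q * P n)).
Proof.
move=> K0 IL I0 IK; exists (K * I (q * q)) => N.
have I00 : I 0 = 0.
  by have := IL (-1) 0 0; rewrite scaler0 addr0 mulN1r addNr.
pose S := \sum_(n < N) I (q * P n) ^+ 2.
pose v := \sum_(n < N) I (q * P n) *: P n.
have Lv : L (v * v) = S.
  rewrite {2}/v mulr_sumr moment_functional_sum; apply: eq_bigr => n _.
  rewrite -scalerAr moment_functionalZ expr2; congr (_ * _).
  rewrite mulr_suml moment_functional_sum (bigD1 n)//= big1 => [|k kn].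
    by rewrite -scalerAl moment_functionalZ orthopoly_orthonormal// eqxx mulr1 addr0.
  rewrite -scalerAl moment_functionalZ orthopoly_orthonormal//.
  by move: kn; rewrite -val_eqE/= => /negPf ->; rewrite mulr0.
have Iqv : I (q * v) = S.
  rewrite /v mulr_sumr /S; elim/big_rec2: _ => [|n x y _ <-]; first exact: I00.
  by rewrite -scalerAr IL expr2.
have := I0 (q - K^-1 *: v).
have -> : (q - K^-1 *: v) * (q - K^-1 *: v) =
    (K^-1 ^+ 2) *: (v * v) + ((- (2 * K^-1)) *: (q * v) + q * q).
  by rewrite -!mul_polyC !rmorphE/=; ring.
rewrite !IL Iqv => h; have := IK v; rewrite Lv => h'.
have S0 : S <= K * I (q * q).
  have Ki : 0 < K^-1 by rewrite invr_gt0.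
  have : K^-1 ^+ 2 * I (v * v) <= K^-1 * S.
    rewrite expr2 -mulrA ler_pM2l// ler_pdivrMl//.
  move=> h2; rewrite -ler_pdivrMl//; lra.
exact: S0.
Qed.

Variables (a b : R).
Hypothesis b_gt0 : 0 < b.

Definition resolvent_poly : {poly R} := ('X - a%:P) ^+ 2 + (b ^+ 2)%:P.
Local Notation w := resolvent_poly.

Lemma size_resolvent_poly : size w = 3%N.
Proof.
rewrite size_polyDl ?size_exp_XsubC//.
by rewrite (leq_ltn_trans (size_polyC_leq1 _)).
Qed.

Let sw : (1 < size w)%N. Proof. by rewrite size_resolvent_poly. Qed.

Lemma modp_resolvent p : p %% w = ((p %% w)`_1) *: 'X + ((p %% w)`_0)%:P.
Proof.
have : (size (p %% w)%R <= 2)%N.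
  have w0 : w != 0 by rewrite -size_poly_gt0 size_resolvent_poly.
  by have := etrans (ltn_modp p w) w0; rewrite size_resolvent_poly.
move=> /poly_sum_coefXn {1}->.
by rewrite !big_ord_recl big_ord0 addr0/= expr0 expr1 addrC alg_polyC.
Qed.

(** [I1] and [I2] abstract the integrals of p/w against two solutions, with [K] a bound for 1/w. *)
Variables (I1 I2 : {poly R} -> R) (K : R).
Hypotheses (K_gt0 : 0 < K)
  (I1_lin : forall a p q, I1 (a *: p + q) = a * I1 p + I1 q)
  (I2_lin : forall a p q, I2 (a *: p + q) = a * I2 p + I2 q)
  (I1_ge0 : forall p, 0 <= I1 (p * p)) (I2_ge0 : forall p, 0 <= I2 (p * p))
  (I1_le : forall p, I1 (p * p) <= K * L (p * p))
  (I2_le : forall p, I2 (p * p) <= K * L (p * p))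
  (I1_w : forall p, I1 (p * w) = L p) (I2_w : forall p, I2 (p * w) = L p)
  (I12 : I1 1 <> I2 1).

Local Notation alpha n := ((P n %% w)`_1).
Local Notation beta n := ((P n %% w)`_0).
Local Notation J p := (I1 p - I2 p).

Let functional_mod (I : {poly R} -> R) (q : {poly R}) n :
  (forall a p q, I (a *: p + q) = a * I p + I q) -> (forall p, I (p * w) = L p) ->
  I (q * P n) = L (q * (P n %/ w)) + (alpha n * I (q * 'X) + beta n * I q).
Proof.
move=> IL Iw; rewrite {1}(divp_eq (P n) w) mulrDr mulrA.
rewrite -[X in I X]scale1r in IL *.
have -> : 1 *: (q * (P n %/ w) * w + q * (P n %% w)) =
    1 *: (q * (P n %/ w) * w) + (alpha n *: (q * 'X) + (beta n *: q + 0)).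
  rewrite addr0 !scale1r; congr (_ + _); rewrite {1}modp_resolvent mulrDr -scalerAr.
  by rewrite -[beta n *: q]mul_polyC [X in _ + X]mulrC.
rewrite !IL mul1r Iw; congr (_ + (_ + _)).
by have := IL (-1) 0 0; rewrite scaler0 addr0 mulN1r addNr => ->; rewrite addr0.
Qed.

(** In the difference J of the two functionals the quotient terms L(q (P_n %/ w)) cancel. Hence
    J(P_n) and J(X P_n), square summable by Bessel, are given by a 2x2 linear system in the two
    remainder coefficients, which is solved by Cramer's rule. *)
Lemma resolvent_rem_summable :
  square_summable (fun n => alpha n) /\ square_summable (fun n => beta n).
Proof.
pose m0 := J 1; pose m1 := J 'X; pose m2 := J ('X * 'X).
have m0n0 : m0 != 0 by rewrite subr_eq0; exact/eqP.
(* J vanishes on w, because both functionals send w to L(1). *)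
have m2E : m2 = 2 * a * m1 - (a ^+ 2 + b ^+ 2) * m0.
  have wE : 'X * 'X = (2 * a) *: 'X + ((- (a ^+ 2 + b ^+ 2)) *: 1 + 1 * w).
    rewrite mul1r /resolvent_poly -!mul_polyC polyCN !polyCD polyCM !expr2 !polyCM.
    by rewrite (_ : 2%:P = 2 :> {poly R}) ?rmorph_nat//; ring.
  by rewrite /m2 wE !I1_lin !I2_lin I1_w I2_w /m1 /m0; ring.
(* This is the determinant m1^2 - m0 m2 after substituting [m2E]; it is positive since b and m0 are
   nonzero. *)
pose D := (m1 - a * m0) ^+ 2 + b ^+ 2 * m0 ^+ 2.
have D0 : 0 < D.
  by rewrite ltr_wpDl ?sqr_ge0// mulr_gt0// exprn_even_gt0//= gt_eqF.
have ssJ q : square_summable (fun n => J (q * P n)).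
  by apply: square_summableB; [apply: (@bessel I1 K q)|apply: (@bessel I2 K q)].
pose u n := J (1 * P n); pose v n := J ('X * P n).
have uE n : u n = alpha n * m1 + beta n * m0.
  by rewrite /u !(functional_mod _ n)// !mul1r /m1 /m0; ring.
have vE n : v n = alpha n * m2 + beta n * m1.
  by rewrite /v !(functional_mod _ n)// /m2 /m1; ring.
split.
- apply: (@eq_square_summable _ (fun n => D^-1 * (m1 * u n - m0 * v n))).
    move=> n; rewrite (_ : _ - _ = D * alpha n) ?mulKf ?gt_eqF//.
    by rewrite uE vE m2E /D; ring.
  by apply: square_summableZ; apply: square_summableB; apply: square_summableZ; exact: ssJ.
- apply: (@eq_square_summable _ (fun n => D^-1 * (m1 * v n - m2 * u n))).
    move=> n; rewrite (_ : _ - _ = D * beta n) ?mulKf ?gt_eqF//.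
    by rewrite uE vE m2E /D; ring.
  by apply: square_summableZ; apply: square_summableB; apply: square_summableZ; exact: ssJ.
Qed.

(** Solve [functional_mod] for the quotient term; every other term is square summable, by Bessel or
    by [resolvent_rem_summable]. *)
Lemma resolvent_quo_summable q : square_summable (fun n => L (q * (P n %/ w))).
Proof.
have [sa sb] := resolvent_rem_summable.
apply: (@eq_square_summable _ (fun n => I1 (q * P n) - (I1 (q * 'X) * alpha n + I1 q * beta n))).
  by move=> n; rewrite (functional_mod _ n)//; ring.
apply: square_summableB; first by apply: (@bessel I1 K q).
by apply: square_summableD; apply: square_summableZ.
Qed.

Lemma resolvent_evaluation_summable :
  square_summable (fun n => (P n).[0]) /\ square_summable (fun n => (P n)^`().[0]).
Proof.
have [sa sb] := resolvent_rem_summable.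
have hr i : (i < (size w).-1)%N -> square_summable (fun n => (P n %% w)`_i).
  by rewrite size_resolvent_poly; case: i => [|[|]].
have hq i : (i < (size w).-1)%N -> square_summable (fun n => L ('X^i * (P n %/ w))).
  by move=> _; exact: resolvent_quo_summable.
split; first exact: square_summable_horner hr hq 0.
exact: square_summable_horner_deriv hr hq 0.
Qed.

End ResolventFunctionals.

(** * Uniqueness of the Stieltjes transform *)

Section StieltjesUniqueness.
Variable R : realType.
Implicit Types rho : {measure set (measurableTypeR R) -> \bar R}.

Lemma integrable_bounded rho (f : measurableTypeR R -> R) (C : R) :
  (rho [set: measurableTypeR R] < +oo)%E ->
  measurable_fun [set: measurableTypeR R] f -> (forall x, `|f x| <= C) ->
  rho.-integrable [set: measurableTypeR R] (EFin \o f).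
Proof.
move=> rhoT mf fC; apply: (integrable_le mf fC).
apply/integrableP; split; first exact/measurable_EFinP/measurable_cst.
have -> : (\int[rho]_x `|(EFin \o cst C) x| = \int[rho]_x (cst `|C|%:E) x)%E by [].
rewrite integral_cst//; apply: lte_mul_pinfty => //.
Qed.

Lemma measurable_horner_inv (w : {poly R}) : (forall x, w.[x] != 0) ->
  measurable_fun [set: measurableTypeR R] (fun x => (w.[x])^-1).
Proof.
move=> w0; apply: continuous_measurable_fun => x; apply: cvgV; first exact: w0.
exact/differentiable_continuous/derivable1_diffP/derivable_horner.
Qed.

Lemma horner_resolvent_poly (a b x : R) :
  (resolvent_poly a b).[x] = (x - a) ^+ 2 + b ^+ 2.
Proof. by rewrite /resolvent_poly hornerD horner_exp hornerXsubC hornerC. Qed.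

Lemma resolvent_poly_bound (a b x : R) : 0 < b -> b ^+ 2 <= (resolvent_poly a b).[x].
Proof. by rewrite horner_resolvent_poly lerDr sqr_ge0. Qed.

Lemma resolvent_poly_gt0 (a b x : R) : 0 < b -> 0 < (resolvent_poly a b).[x].
Proof. by move=> b0; apply: lt_le_trans (resolvent_poly_bound a x b0); rewrite exprn_gt0. Qed.

(** An antiderivative in [a] of the Poisson kernel b / ((x - a)^2 + b^2). *)
Definition atan_kernel (b a x : R) : R := atan ((a - x) / b).

Lemma is_derive_atan_kernel (b a x : R) : b != 0 ->
  is_derive a 1 (fun a => atan_kernel b a x) (b / ((x - a) ^+ 2 + b ^+ 2)).
Proof.
move=> b0; pose p : {poly R} := b^-1 *: ('X - x%:P).
have -> : (fun a => atan_kernel b a x) = atan \o horner p.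
  apply/funext => y; rewrite /atan_kernel /p/= hornerZ hornerXsubC.
  by rewrite mulrC.
have D : (x - a) ^+ 2 + b ^+ 2 != 0.
  by rewrite gt_eqF// ltr_wpDl ?sqr_ge0// exprn_even_gt0.
have -> : b / ((x - a) ^+ 2 + b ^+ 2) = (1 + p.[a] ^+ 2)^-1 * p^`().[a].
  rewrite /p hornerZ hornerXsubC derivZ derivXsubC hornerZ hornerC mulr1.
  have E : 1 + (b^-1 * (a - x)) ^+ 2 = ((x - a) ^+ 2 + b ^+ 2) * b^-1 ^+ 2.
    by field.
  rewrite E; move: (_ + _) D => d dn0.
  by field; rewrite ?dn0 ?b0.
apply: is_derive1_comp; exact: is_derive_poly.
Qed.

Lemma measurable_atan_kernel (b a : R) :
  measurable_fun [set: measurableTypeR R] (atan_kernel b a).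
Proof.
apply: continuous_measurable_fun => x.
have c : {for (a - x) / b, continuous (@atan R)} by exact: continuous_atan.
apply: (@continuous_comp _ _ _ (fun x => (a - x) / b) atan); last exact: c.
by apply: cvgMl; apply: cvgB; [exact: cvg_cst|exact: cvg_id].
Qed.

Lemma atan_kernel_bound (b a x : R) : `|atan_kernel b a x| <= pi.
Proof.
have := atan_gtNpi2 ((a - x) / b); have := atan_ltpi2 ((a - x) / b).
have := pi_gt0 R; rewrite -/(atan_kernel b a x) ler_norml => h1 h2 h3.
by apply/andP; split; lra.
Qed.

(** Differentiation under the integral: the Poisson kernel is at most 1/b, a constant that is
    integrable for a finite measure. *)
Lemma is_derive_atan_potential rho (b a : R) : 0 < b ->
  (rho [set: measurableTypeR R] < +oo)%E ->
  is_derive a 1 (fun a => Rintegral rho [set: measurableTypeR R] (atan_kernel b a))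
    (b * Rintegral rho [set: measurableTypeR R] (fun x => ((x - a) ^+ 2 + b ^+ 2)^-1)).
Proof.
move=> b0 rhoT; have bn0 : b != 0 by rewrite gt_eqF.
have Ia : `](a - 1), (a + 1)[%classic a by rewrite /= in_itv/= ltrBlDr ltrDl ltr01.
have Iint c : rho.-integrable [set: measurableTypeR R] (EFin \o atan_kernel b c).
  exact: (integrable_bounded rhoT (measurable_atan_kernel b c) (atan_kernel_bound b c)).
have Ider c y : derivable ((atan_kernel b)^~ y) c 1.
  exact: (@ex_derive _ _ _ _ _ _ _ (is_derive_atan_kernel c y bn0)).
have dE c y : partial1of2 (atan_kernel b) c y = b / ((y - c) ^+ 2 + b ^+ 2).
  by rewrite partial1of2E; exact: (@derive_val _ _ _ _ _ _ _ (is_derive_atan_kernel c y bn0)).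
have G0 (y : measurableTypeR R) : 0 <= b^-1 by rewrite invr_ge0 ltW.
have IG : rho.-integrable [set: measurableTypeR R] (EFin \o (fun=> b^-1)).
  by apply: (@integrable_bounded rho _ `|b^-1|).
have Gb c y : `|partial1of2 (atan_kernel b) c y| <= b^-1.
  have D : b ^+ 2 <= (y - c) ^+ 2 + b ^+ 2 by rewrite lerDr sqr_ge0.
  have D0 : 0 < (y - c) ^+ 2 + b ^+ 2 by apply: lt_le_trans D; rewrite exprn_gt0.
  rewrite dE ger0_norm ?divr_ge0 ?(ltW b0) ?(ltW D0)//.
  by rewrite ler_pdivrMr// ler_pdivlMl// -expr2.
apply: DeriveDef.
  exact: (@derivable_under_integral _ _ _ rho _ _ measurableT _ _ _ Ia
    (fun c _ => Iint c) (fun c y _ _ => Ider c y) _ G0 IG (fun c y _ _ => Gb c y)).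
rewrite -derive1E (@differentiation_under_integral _ _ _ rho _ _ measurableT _ _ _ Ia
    (fun c _ => Iint c) (fun c y _ _ => Ider c y) _ G0 IG (fun c y _ _ => Gb c y)).
under eq_Rintegral do rewrite dE.
rewrite RintegralZl//; apply: (@integrable_bounded rho _ (b ^+ 2)^-1) => //.
  under eq_fun do rewrite -horner_resolvent_poly.
  by apply: measurable_horner_inv => x; rewrite gt_eqF ?resolvent_poly_gt0.
move=> x; have D : b ^+ 2 <= (x - a) ^+ 2 + b ^+ 2 by rewrite lerDr sqr_ge0.
have b2 : 0 < b ^+ 2 by rewrite exprn_gt0.
rewrite ger0_norm ?invr_ge0 ?(le_trans (ltW b2))//.
by rewrite lef_pV2 ?posrE// (lt_le_trans b2).
Qed.

(** The difference of the two potentials has zero derivative, hence is constant, so their increments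
    from [c] to [d] agree. *)
Lemma atan_potential_eq rho1 rho2 (b : R) : 0 < b ->
  (rho1 [set: measurableTypeR R] < +oo)%E -> (rho2 [set: measurableTypeR R] < +oo)%E ->
  (forall a, Rintegral rho1 [set: measurableTypeR R] (fun x => ((x - a) ^+ 2 + b ^+ 2)^-1) =
    Rintegral rho2 [set: measurableTypeR R] (fun x => ((x - a) ^+ 2 + b ^+ 2)^-1)) ->
  forall c d,
    Rintegral rho1 [set: measurableTypeR R] (fun x => atan_kernel b d x - atan_kernel b c x) =
    Rintegral rho2 [set: measurableTypeR R] (fun x => atan_kernel b d x - atan_kernel b c x).
Proof.
move=> b0 r1 r2 E c d.
have Iint rho a : (rho [set: measurableTypeR R] < +oo)%E ->
    rho.-integrable [set: measurableTypeR R] (EFin \o atan_kernel b a).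
  move=> r; exact: (integrable_bounded r (measurable_atan_kernel b a) (atan_kernel_bound b a)).
rewrite !RintegralB//; try exact: Iint.
pose V rho (a : R) := Rintegral rho [set: measurableTypeR R] (atan_kernel b a).
suff : (V rho1 - V rho2) d = (V rho1 - V rho2) c.
  by rewrite !fctE -!/(V _ _); lra.
apply: is_derive_0_is_cst => a.
have := is_deriveB (is_derive_atan_potential a b0 r1) (is_derive_atan_potential a b0 r2).
by rewrite E subrr.
Qed.

Lemma cvg_atan_y (u : nat -> R) : (\forall n \near \oo, n%:R <= u n) ->
  atan (u n) @[n --> \oo] --> pi / 2.
Proof.
move=> un; apply: cvg_comp (@cvgy_atan R); apply/cvgryPge => B; near=> n.
apply: (@le_trans _ _ n%:R); last by near: n; exact: un.
by near: n; exact: nbhs_infty_ger.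
Unshelve. all: end_near. Qed.

Lemma cvg_atan_Ny (u : nat -> R) : (\forall n \near \oo, u n <= - n%:R) ->
  atan (u n) @[n --> \oo] --> - (pi / 2).
Proof.
move=> un; have -> : (fun n => atan (u n)) = (fun n => - atan (- u n)).
  by apply/funext => n; rewrite atanN opprK.
apply: cvgN; apply: (@cvg_atan_y (fun n => - u n)).
by apply: filterS un => n; rewrite lerNr.
Qed.

(* pi times the indicator of ]-oo, x] is the bounded pointwise limit of these
   Poisson integrals. *)
Lemma cvg_atan_kernel (x y : R) :
  atan_kernel (n.+1%:R ^- 2) (x + n.+1%:R^-1) y - atan_kernel (n.+1%:R ^- 2) (- n.+1%:R) y
    @[n --> \oo] --> pi * (y <= x)%R%:R.
Proof.
have -> : pi * (y <= x)%R%:R = (if y <= x then pi / 2 else - (pi / 2)) - - (pi / 2) :> R.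
  by case: (y <= x); rewrite ?mulr1 ?mulr0; lra.
apply: cvgB; last first.
  apply: cvg_atan_Ny; near=> n.
  rewrite invrK; have n0 : (0 : R) <= n%:R by [].
  have ny : - y <= n%:R by near: n; exact: nbhs_infty_ger.
  rewrite -natr1; nra.
case: (leP y x) => yx.
  apply: cvg_atan_y; near=> n.
  rewrite invrK mulrC; have n1 : (0 : R) < n.+1%:R by [].
  (* The shift 1/(n+1) is large compared with b = (n+1)^-2, so the argument tends to +oo even at y =
     x; this yields the closed half-line. *)
  have -> : n.+1%:R ^+ 2 * (x + n.+1%:R^-1 - y) = n.+1%:R + n.+1%:R ^+ 2 * (x - y).
    by field; rewrite gt_eqF.
  rewrite -natr1 -addrA lerDl addr_ge0// mulr_ge0 ?sqr_ge0// subr_ge0//.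
apply: cvg_atan_Ny; near=> n.
rewrite invrK mulrC; have n1 : (0 : R) < n.+1%:R by [].
have -> : n.+1%:R ^+ 2 * (x + n.+1%:R^-1 - y) = n.+1%:R * (1 - n.+1%:R * (y - x)).
  by field; rewrite gt_eqF.
(* Once (n+1)(y - x) >= 2, the argument is at most -(n+1). *)
have ny : 2 / (y - x) <= n%:R by near: n; exact: nbhs_infty_ger.
have : 2 <= n.+1%:R * (y - x).
  rewrite -ler_pdivrMr ?subr_gt0//; apply: le_trans ny _.
  by rewrite ler_nat.
have : n%:R <= n.+1%:R :> R by rewrite ler_nat.
nra.
Unshelve. all: end_near. Qed.

(** Increments of the potentials agree, and dominated convergence with the constant 2 pi carries
    this over to half-lines. *)
Lemma stieltjes_uniqueness rho1 rho2 :
  (rho1 [set: measurableTypeR R] < +oo)%E -> (rho2 [set: measurableTypeR R] < +oo)%E ->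
  (forall a b, 0 < b ->
    Rintegral rho1 [set: measurableTypeR R] (fun x => ((x - a) ^+ 2 + b ^+ 2)^-1) =
    Rintegral rho2 [set: measurableTypeR R] (fun x => ((x - a) ^+ 2 + b ^+ 2)^-1)) ->
  forall A : set (measurableTypeR R), measurable A -> rho1 A = rho2 A.
Proof.
move=> r1 r2 E.
have Iint rho b a : (rho [set: measurableTypeR R] < +oo)%E ->
    rho.-integrable [set: measurableTypeR R] (EFin \o atan_kernel b a).
  move=> r; exact: (integrable_bounded r (measurable_atan_kernel b a) (atan_kernel_bound b a)).
have ray x : rho1 `]-oo, x]%classic = rho2 `]-oo, x]%classic.
  pose h n y := atan_kernel (n.+1%:R ^- 2) (x + n.+1%:R^-1) y -
                atan_kernel (n.+1%:R ^- 2) (- n.+1%:R) y.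
  have mh n : measurable_fun [set: measurableTypeR R] (h n).
    by apply: measurable_funB; exact: measurable_atan_kernel.
  have hb n y : `|h n y| <= pi + pi.
    by apply: le_trans (ler_normB _ _) _; rewrite lerD ?atan_kernel_bound.
  have mA : measurable (`]-oo, x]%classic : set (measurableTypeR R)) by exact: measurable_itv.
  have cvgh rho : (rho [set: measurableTypeR R] < +oo)%E ->
      (Rintegral rho [set: measurableTypeR R] (h n))%:E @[n --> \oo] -->
      (pi%:E * rho `]-oo, x]%classic)%E.
    move=> r; have Ih n : rho.-integrable [set: measurableTypeR R] (EFin \o h n).
      exact: (integrable_bounded r (mh n) (hb n)).
    have -> : (pi%:E * rho `]-oo, x]%classic = \int[rho]_y (pi * \1_(`]-oo, x]%classic) y)%:E)%E.
      rewrite -[in LHS](setIT `]-oo, x]%classic) -integral_indic//.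
      rewrite -ge0_integralZl//=; first exact/measurable_EFinP/measurable_indic.
      by rewrite lee_fin pi_ge0.
    have -> : (fun n => (Rintegral rho [set: measurableTypeR R] (h n))%:E) =
        (fun n => \int[rho]_y (h n y)%:E)%E.
      by apply/funext => n; rewrite /Rintegral fineK//; exact: integrable_fin_num (Ih n).
    apply: (@dominated_cvg _ _ _ rho setT measurableT _ _ (fun=> (pi + pi)%:E)) => //.
    - by move=> n; exact/measurable_EFinP.
    - move=> y _; apply/cvg_EFin; first by near=> n.
      have -> : \1_(`]-oo, x]%classic) y = (y <= x)%R%:R :> R.
        rewrite indicE; congr (nat_of_bool _)%:R.
        by apply/idP/idP => [/set_mem|yx]; [|apply/mem_set]; rewrite /= in_itv.
      exact: cvg_atan_kernel.
    - apply: (integrable_bounded r (measurable_cst _) (fun=> lexx `|pi + pi|)).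
    - by move=> n y _; rewrite /= lee_fin.
  have h12 n : Rintegral rho1 [set: measurableTypeR R] (h n) =
               Rintegral rho2 [set: measurableTypeR R] (h n).
    have n0 : (0 : R) < n.+1%:R ^- 2 by rewrite invr_gt0 exprn_gt0.
    by apply: (atan_potential_eq n0 r1 r2) => a; exact: E.
  have := cvgh _ r1; under eq_fun do rewrite h12; move=> l1.
  have e : (pi%:E * rho1 `]-oo, x]%classic = pi%:E * rho2 `]-oo, x]%classic)%E.
    exact: cvg_unique l1 (cvgh _ r2).
  have fin rho : (rho [set: measurableTypeR R] < +oo)%E -> rho `]-oo, x]%classic \is a fin_num.
    move=> r; rewrite ge0_fin_numE ?measure_ge0//; apply: le_lt_trans r.
    by apply: le_measure; rewrite ?inE.
  move: e; rewrite -(fineK (fin _ r1)) -(fineK (fin _ r2)) -!EFinM => -[].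
  by move=> /(mulfI (lt0r_neq0 (pi_gt0 R))) ->.
(* Half-open intervals are stable under intersection, generate the Borel sets and exhaust the line;
   their finite measures are differences of those of half-lines. *)
apply: (@measure_unique _ R (measurableTypeR R) (@ocitv R) (fun n => `]- n%:R, n%:R]%classic)).
- by [].
- exact: ocitvI.
- by move=> n; exact: is_ocitv.
- exact: bigcup_itvT.
- move=> _ [[a b] _ <-] /=.
  have [ab|ba] := leP a b; last by rewrite set_itv_ge ?measure0// bnd_simp -leNgt ltW.
  have -> : `]a, b]%classic = `]-oo, b]%classic `\` `]-oo, a]%classic.
    apply/seteqP; split => y /=; rewrite !in_itv/=.
      by move=> /andP[ay yb]; split => //; apply/negP; rewrite -ltNge.
    by move=> [yb /negP]; rewrite -ltNge => ay; rewrite ay yb.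
  have fin rho : (rho [set: measurableTypeR R] < +oo)%E -> (rho `]-oo, b]%classic < +oo)%E.
    by move=> r; apply: le_lt_trans r; apply: le_measure; rewrite ?inE.
  have diff rho : (rho [set: measurableTypeR R] < +oo)%E ->
      rho (`]-oo, b]%classic `\` `]-oo, a]%classic) =
      (rho `]-oo, b]%classic - rho `]-oo, a]%classic)%E.
    move=> r; rewrite measureD; [|exact: measurable_itv|exact: measurable_itv|exact: fin].
    congr (_ - rho _)%E; apply/seteqP; split => y /=; rewrite !in_itv/=; first by case.
    by move=> ya; split => //; exact: le_trans ab.
  by rewrite !diff// !ray.
- move=> n; apply: le_lt_trans r1; apply: le_measure; rewrite ?inE//.
Unshelve. all: end_near. Qed.

End StieltjesUniqueness.

(** * The determinacy criterion *)

Section Indeterminate.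
Variables (R : realType) (s : nat -> R).
Hypothesis s_pos : forall N : nat, posdefmx (hankelmx s N).
Local Notation L := (moment_functional s).
Local Notation P := (orthopoly s).

(** * Integration of p/w against a solution *)

Section Resolvent.
Variable rho : {measure set (measurableTypeR R) -> \bar R}.
Hypothesis rho_sol : hamburger_solution s rho.
Variables (a b : R).
Hypothesis b_gt0 : 0 < b.
Local Notation w := (resolvent_poly a b).

Definition resolvent_functional (p : {poly R}) : R :=
  Rintegral rho [set: measurableTypeR R] (fun x => p.[x] / w.[x]).
Local Notation I := resolvent_functional.

Let w0 x : 0 < w.[x]. Proof. exact: resolvent_poly_gt0. Qed.
Let wn0 x : w.[x] != 0. Proof. by rewrite gt_eqF. Qed.
Let b2 : 0 < b ^- 2. Proof. by rewrite invr_gt0 exprn_gt0. Qed.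

Let inv_w x : (w.[x])^-1 <= b ^- 2.
Proof. by rewrite lef_pV2 ?posrE ?exprn_gt0// resolvent_poly_bound. Qed.

Let integrable_w p : rho.-integrable [set: measurableTypeR R] (EFin \o (fun x => p.[x] / w.[x])).
Proof.
(* Since |p| <= 1 + p^2 and 1/w <= b^-2, the quotient p/w is dominated by this polynomial. *)
have [Ip _] := hamburger_solution_poly rho_sol (b ^- 2 *: (1 + p * p)).
apply: integrable_le Ip.
  by apply: measurable_funM; [exact: measurable_poly|exact: measurable_horner_inv].
move=> x; rewrite normrM normfV [`|w.[x]|]gtr0_norm// [leRHS]hornerZ mulrC.
apply: ler_pM => //; first by rewrite invr_ge0 ltW.
rewrite hornerD hornerM hornerC.
have := sqr_ge0 (p.[x] - 1); have := sqr_ge0 (p.[x] + 1).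
by move=> h1 h2; rewrite ler_norml; apply/andP; split; nra.
Qed.

Lemma resolvent_functional_linear c p q : I (c *: p + q) = c * I p + I q.
Proof.
rewrite /I -Rintegral_lin; try exact: integrable_w.
by apply: eq_Rintegral => x _; rewrite [(c *: p + q).[x]]hornerD hornerZ mulrDl mulrA.
Qed.

Lemma resolvent_functional_sqr_ge0 p : 0 <= I (p * p).
Proof.
apply: Rintegral_ge0 => x _; apply: divr_ge0; last exact: ltW.
by rewrite hornerM -expr2 sqr_ge0.
Qed.

Lemma resolvent_functional_sqr_le p : I (p * p) <= b ^- 2 * L (p * p).
Proof.
have [Ip Ep] := hamburger_solution_poly rho_sol (b ^- 2 *: (p * p)).
rewrite -moment_functionalZ -Ep; apply: le_Rintegral => // x _.
rewrite [leRHS]hornerZ mulrC ler_wpM2r ?inv_w//.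
by rewrite hornerM -expr2 sqr_ge0.
Qed.

Lemma resolvent_functional_mulw p : I (p * w) = L p.
Proof.
have [_ <-] := hamburger_solution_poly rho_sol p.
by apply: eq_Rintegral => x _; rewrite [(p * w).[x]]hornerM mulfK.
Qed.

End Resolvent.

Lemma indeterminate_summable : hamburger_indeterminate s ->
  square_summable (fun n => (P n).[0]) /\ square_summable (fun n => (P n)^`().[0]).
Proof.
move=> [rho1 [rho2 [sol1 sol2 [A mA nA]]]].
(* If all these integrals agreed, uniqueness of the Stieltjes transform would identify the two
   measures on [A]. *)
have [a [b [b0 I12]]] : exists a b, 0 < b /\
    resolvent_functional rho1 a b 1 <> resolvent_functional rho2 a b 1.
  apply: contrapT => nex; apply: nA.
  apply: stieltjes_uniqueness => //.
  - by rewrite (hamburger_solution_mass sol1) ltry.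
  - by rewrite (hamburger_solution_mass sol2) ltry.
  move=> a b b0; apply: contrapT => E; apply: nex; exists a, b; split => //.
  have IE rho : resolvent_functional rho a b 1 =
      Rintegral rho [set: measurableTypeR R] (fun x => ((x - a) ^+ 2 + b ^+ 2)^-1).
    by apply: eq_Rintegral => x _; rewrite [1.[x]]hornerC mul1r horner_resolvent_poly.
  by rewrite !IE.
have K0 : 0 < b ^- 2 by rewrite invr_gt0 exprn_gt0.
apply: (@resolvent_evaluation_summable _ s s_pos a b b0
  (resolvent_functional rho1 a b) (resolvent_functional rho2 a b) _ K0) => //.
- exact: resolvent_functional_linear.
- exact: resolvent_functional_linear.
- exact: resolvent_functional_sqr_ge0.
- exact: resolvent_functional_sqr_ge0.
- exact: resolvent_functional_sqr_le.
- exact: resolvent_functional_sqr_le.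
- exact: resolvent_functional_mulw.
- exact: resolvent_functional_mulw.
Qed.

End Indeterminate.

(** The partial sums are nondecreasing, so they always converge in the extended reals; a finite
    limit is their supremum and hence a bound. *)
Lemma square_summableP (R : realType) (u : nat -> R) :
  square_summable u <->
  (cvgn (fun N => (\sum_(n < N) u n ^+ 2)%:E) /\
   (limn (fun N => (\sum_(n < N) u n ^+ 2)%:E) < +oo)%E).
Proof.
have nd : nondecreasing_seq (fun N => (\sum_(n < N) u n ^+ 2)%:E).
  apply/nondecreasing_seqP => N; rewrite lee_fin big_ord_recr/= lerDl.
  exact: sqr_ge0.
have cv := ereal_nondecreasing_is_cvgn nd.
split=> [[B uB]|[_ lim_lt]].
  split=> //; apply: (@le_lt_trans _ _ B%:E); last exact: ltry.
  by apply: lime_le => //; apply: nearW => N; rewrite lee_fin.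
have le_lim N : ((\sum_(n < N) u n ^+ 2)%:E <=
    limn (fun N => (\sum_(n < N) u n ^+ 2)%:E))%E.
  by rewrite (cvg_lim _ (ereal_nondecreasing_cvgn nd))//; apply: ereal_sup_ubound; exists N.
exists (fine (limn (fun N => (\sum_(n < N) u n ^+ 2)%:E))) => N.
rewrite -lee_fin fineK// ge0_fin_numE//.
by apply: le_trans (le_lim 0%N); rewrite big_ord0.
Qed.

Theorem proposition12 (R : realType) (s : nat -> R)
  (s0 : s 0%N = 1)
  (s_pos : forall N : nat, posdefmx (hankelmx s N)) :
  let gamma (T : nat) : \bar R :=
    (dotprod (invmx (connecting_mx s T) *m Gamma_vec T) (Gamma_vec T))%:E in
  let omega (T : nat) : \bar R :=
    (dotprod (invmx (connecting_mx s T) *m Omega_vec T) (Omega_vec T))%:E in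
  hamburger_indeterminate s <->
  (cvgn gamma /\ (limn gamma < +oo)%E) /\
  (cvgn omega /\ (limn omega < +oo)%E).
Proof.
move=> gamma omega.
have -> : gamma = fun T => (\sum_(n < T) (orthopoly s n).[0] ^+ 2)%:E.
  by apply/funext => T; rewrite /gamma connecting_form_Gamma.
have -> : omega = fun T => (\sum_(n < T) (orthopoly s n)^`().[0] ^+ 2)%:E.
  by apply/funext => T; rewrite /omega connecting_form_Omega.
split=> [/(indeterminate_summable s_pos)[sP sP']|[sP sP']].
  by split; [exact: (square_summableP _).1 sP|exact: (square_summableP _).1 sP'].
apply: square_summable_indeterminate => //.
  exact: (square_summableP (fun n => (orthopoly s n).[0])).2 sP.
exact: (square_summableP (fun n => (orthopoly s n)^`().[0])).2 sP'.
Qed.
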